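(* Let $k$ be $\mathbb{R}$ or $\mathbb{C}$, let $(\mathcal{L},\mathcal{B},(\cdot,\cdot))$ be a Maurer–Cartan–Poisson (MCP) structure over $k$ with $L$ finite-dimensional, and let $\mathcal{O}\subseteq\mathrm{MC}(\mathcal{L})$ be a set of gauge orbits (a union of gauge orbits). Let $\mathcal{I}\subset C^\infty(L^1)$ be the ideal of smooth functions vanishing on $\mathcal{O}$ and $\mathcal{R}_{\mathcal{O}}=C^\infty(L^1)/\mathcal{I}$. Then the operation $\{\cdot,\cdot\}:\mathcal{R}_{\mathcal{O}}\times\mathcal{R}_{\mathcal{O}}\to\mathcal{R}_{\mathcal{O}}$ given by $$\{[f],[g]\}=(X,\ \delta_XDf\wedge\delta_XDg)$$ (the class of the function $X\mapsto (X,\delta_XDf\wedge\delta_XDg)$ on $L^1$) gives $\mathcal{R}_{\mathcal{O}}$ the structure of a Poisson algebra.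
   Context: For a differential graded Lie algebra (dgla) $\mathcal{L}=(L,d,[\cdot,\cdot])$, $\mathrm{MC}(\mathcal{L})=\{X\in L^1: dX+\frac12[X,X]=0\}$, and $d_X=d+[X,\cdot]$ for $X\in L^1$. The Lie algebra $L^0$ acts on $L^1$ by the vector fields $X\mapsto d\lambda+[X,\lambda]$; their flows preserve $\mathrm{MC}(\mathcal{L})$ and decompose it into gauge orbits. A BV algebra $(B,\delta,\wedge)$ is a graded vector space $B$ with an associative graded commutative product $\wedge:B^i\times B^j\to B^{i+j}$ and a differential $\delta:B^i\to B^{i-1}$, $\delta^2=0$, such that $[a,b]_{\mathcal{B}}=(-1)^{|a|}(\delta(a\wedge b)-\delta a\wedge b-(-1)^{|a|}a\wedge\delta b)$ is a graded Lie bracket (with degrees shifted by one), and $\delta$ is of order two: $\delta(a\wedge b\wedge c)-\delta(a\wedge b)\wedge c+\delta a\wedge b\wedge c-(-1)^{|a|}a\wedge\delta(b\wedge c)-(-1)^{(|a|+1)|b|}b\wedge\delta(a\wedge c)+(-1)^{|a|}a\wedge\delta b\wedge c+(-1)^{|a|+|b|}a\wedge b\wedge\delta c=0.$ An MCP structure with base dgla $\mathcal{L}$ is a triple $(\mathcal{L},\mathcal{B},(\cdot,\cdot))$ of a dgla $\mathcal{L}$, a graded commutative algebra $\mathcal{B}=(B,\wedge)$ and non-degenerate bilinear pairings $(\cdot,\cdot):L^i\times B^{i+1}\to k$ such that for each $X\in\mathrm{MC}(\mathcal{L})$: (1) $d_XX=0$; (2) the map $\delta_X:B^i\to B^{i-1}$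 defined by $(d_X\,\cdot,\cdot)=(\cdot,\delta_X\,\cdot)$ makes $\mathcal{B}_X=(B,\delta_X,\wedge)$ a BV algebra; (3) there is $k_X\in k$ such that the linear map $\rho_X:B^1\to L^0$ defined by $(X,a\wedge b)=(\rho_Xa,b)$ satisfies $[\rho_Xa,\rho_Xb]=k_X\rho_X[a,b]_{\mathcal{B}_X}$ for all $a,b\in B^1$. The operator $\delta_X$ is defined as the adjoint of $d_X$ for every $X\in L^1$. For $f\in C^\infty(L^1)$, $Df$ is its de Rham differential regarded, via the isomorphism $T_X^*L^1=(L^1)^\vee\cong B^2$ given by the pairing, as a function $L^1\to B^2$. *)

(* Defs.v *)
From HB Require Import structures.
From mathcomp Require Import all_boot all_order all_algebra generic_quotient.
From mathcomp Require Import ring_quotient complex.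
From mathcomp Require Import all_classical all_reals all_analysis.

Set Implicit Arguments.
Unset Strict Implicit.
Unset Printing Implicit Defensive.

Import Order.TTheory GRing.Theory Num.Theory.
Import numFieldNormedType.Exports VectorInternalTheory.

Local Open Scope classical_set_scope.
Local Open Scope ring_scope.
Local Open Scope quotient_scope.

(* The two ground fields: any model of the real numbers, or R[i] over it. *)
Variant real_or_complex : numFieldType -> Prop :=
  | RC_real (R : realType) : real_or_complex R
  | RC_complex (R : realType) : real_or_complex R[i].

(* A finite-dimensional space V is topologised through its coordinates
   r2v : 'rV_(dim V) -> V; smoothness does not depend on this choice. All
   derivatives are K-linear, so over the complex numbers "smooth" means
   holomorphic; this is what makes the differential of f at X an element of
   the K-linear dual of V. *)
Section Smooth.
Variable K : numFieldType.

Fixpoint Ck (m n : nat) (f : 'rV[K]_m -> K) : Prop :=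
  if n is n'.+1 then
    (forall x, differentiable f x) /\ (forall v, Ck n' (fun x => 'D_v f x))
  else continuous f.

Variable V : vectType K.

Definition smooth : {pred V -> K} :=
  [pred f : V -> K | `[< forall n, Ck n (f \o r2v) >]].

Definition dirD (f : V -> K) (X v : V) : K := 'D_(v2r v) (f \o r2v) (v2r X).

End Smooth.

Section SmoothClosed.
Variable K : numFieldType.

Lemma CkS m n (f : 'rV[K]_m -> K) : Ck n.+1 f -> Ck n f.
Proof.
elim: n f => [|n IHn] f.
  by move=> [df _] x; exact: differentiable_continuous.
by move=> [df Df]; split=> // v; apply: IHn; exact: Df.
Qed.

Lemma Ck_cst m n (c : K) : Ck n (cst c : 'rV[K]_m -> K).
Proof.
elim: n c => [|n IHn] c; first exact: cst_continuous.
split=> [x|v]; first exact: differentiable_cst.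
rewrite (_ : (fun x => _) = cst 0); first exact: IHn.
by apply/funext=> x; rewrite derive_cst.
Qed.

Lemma CkD m n (f g : 'rV[K]_m -> K) : Ck n f -> Ck n g -> Ck n (f + g).
Proof.
elim: n f g => [|n IHn] f g.
  by move=> cf cg x; apply: (@continuousD _ _ _ f g); [exact: cf|exact: cg].
move=> [df Df] [dg Dg]; split=> [x|v]; first exact: differentiableD.
rewrite (_ : (fun x => _) = (fun x => 'D_v f x) + (fun x => 'D_v g x)).
  by apply: IHn; [exact: Df|exact: Dg].
by apply/funext=> x; rewrite deriveD //; exact: diff_derivable.
Qed.

Lemma CkM m n (f g : 'rV[K]_m -> K) : Ck n f -> Ck n g -> Ck n (f * g).
Proof.
elim: n f g => [|n IHn] f g.
  by move=> cf cg x; apply: (@continuousM _ _ f g); [exact: cf|exact: cg].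
move=> cf cg; have [df Df] := cf; have [dg Dg] := cg.
split=> [x|v]; first exact: differentiableM.
rewrite (_ : (fun x => _) =
  f * (fun x => 'D_v g x) + g * (fun x => 'D_v f x)).
  by apply: CkD; apply: IHn; do ?[exact: Df|exact: Dg|exact: CkS].
by apply/funext=> x; rewrite deriveM //; exact: diff_derivable.
Qed.

Variable V : vectType K.

Lemma smoothP (f : V -> K) :
  reflect (forall n, Ck n (f \o r2v)) (f \in @smooth K V).
Proof. exact: asboolP. Qed.

Lemma smooth_subring : subring_closed (@smooth K V).
Proof.
have cstP c : cst c \in @smooth K V by apply/smoothP => n; exact: Ck_cst.
have mulP : {in @smooth K V &, forall f g, f * g \in @smooth K V}.
  move=> f g /smoothP cf /smoothP cg; apply/smoothP => n.
  exact: (CkM (cf n) (cg n)).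
split=> [|f g /smoothP cf sg|]; [exact: cstP| |exact: mulP]; apply/smoothP => n.
have /smoothP/(_ n) cg : (cst (-1) : V -> K) * g \in @smooth K V.
  exact: mulP.
rewrite (_ : _ \o _ = (f \o r2v : 'rV_(dim V) -> K) +
  (((cst (-1) : V -> K) * g : V -> K) \o r2v)).
  exact: CkD.
by apply/funext => x /=; rewrite !fctE /= mulN1r.
Qed.

HB.instance Definition _ :=
  GRing.isSubringClosed.Build (V -> K) (@smooth K V) smooth_subring.

Lemma smooth_scale : GRing.scaler_closed (@smooth K V).
Proof.
move=> c f sf; rewrite (_ : c *: f = cst c * f) ?rpredM //.
by apply/smoothP => n; exact: Ck_cst.
Qed.

HB.instance Definition _ :=
  GRing.isScaleClosed.Build K (V -> K) (@smooth K V) smooth_scale.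

Record Cinfty :=
  MkCinfty { Cinfty_fun :> V -> K; _ : Cinfty_fun \in @smooth K V }.

HB.instance Definition _ := [isSub for Cinfty_fun].
HB.instance Definition _ := [Choice of Cinfty by <:].
HB.instance Definition _ :=
  GRing.SubChoice_isSubComPzRing.Build _ _ Cinfty (subringClosedP _).
HB.instance Definition _ := [SubZmodule_isSubLmodule of Cinfty by <:].

End SmoothClosed.

Section VanishingIdeal.
Variables (K : numFieldType) (V : vectType K) (O : set V).

Definition vanishing : {pred Cinfty V} :=
  [pred f : Cinfty V | `[< forall X, O X -> f X = 0 >]].

Lemma vanishingP (f : Cinfty V) :
  reflect (forall X, O X -> f X = 0) (f \in vanishing).
Proof. exact: asboolP. Qed.

Lemma vanishing_zmod : zmod_closed vanishing.
Proof.
split; first exact/vanishingP.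
move=> f g /vanishingP f0 /vanishingP g0; apply/vanishingP => X OX.
have -> : (f - g) X = f X - g X by [].
by rewrite f0 // g0 // subrr.
Qed.

HB.instance Definition _ :=
  GRing.isZmodClosed.Build (Cinfty V) vanishing vanishing_zmod.

Lemma vanishingM (f g : Cinfty V) : g \in vanishing -> f * g \in vanishing.
Proof.
move=> /vanishingP g0; apply/vanishingP => X OX.
have -> : (f * g) X = f X * g X by [].
by rewrite g0 // mulr0.
Qed.

Lemma vanishingZ (c : K) (f : Cinfty V) : f \in vanishing -> c *: f \in vanishing.
Proof.
move=> /vanishingP f0; apply/vanishingP => X OX.
have -> : (c *: f) X = c * f X by [].
by rewrite f0 // mulr0.
Qed.

(* Not mathcomp's {ideal_quot _}, which requires a proper ideal: O may be
   empty, in which case the quotient is the zero ring. *)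
Definition functions_on := Quotient.quot vanishing.

Local Notation Q := functions_on.
Local Notation "[: f ]" := (\pi_Q f) (at level 0, format "[: f ]").

HB.instance Definition _ := EqQuotient.on Q.
HB.instance Definition _ := GRing.Zmodule.on Q.

Lemma functions_onP (f g : Cinfty V) :
  [: f] = [: g] <-> (forall X, O X -> f X = g X).
Proof.
split=> [/eqP|fg].
  rewrite -Quotient.idealrBE => /vanishingP fg X OX.
  by apply/eqP; rewrite -subr_eq0; apply/eqP; exact: fg.
apply/eqP; rewrite -Quotient.idealrBE; apply/vanishingP => X OX.
have -> : (f - g) X = f X - g X by [].
by rewrite fg // subrr.
Qed.

Let reprE (f : Cinfty V) X : O X -> (repr [: f] : Cinfty V) X = f X.
Proof. by move: X; apply/functions_onP; rewrite reprK. Qed.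

Definition fo_one : Q := [: 1].
Definition fo_mul (u v : Q) : Q := [: repr u * repr v].
Definition fo_scale (c : K) (u : Q) : Q := [: c *: repr u].

Let mulX (f g : Cinfty V) X : (f * g) X = f X * g X. Proof. by []. Qed.
Let scaleX c (f : Cinfty V) X : (c *: f) X = c * f X. Proof. by []. Qed.
Let piD (f g : Cinfty V) : [: f + g] = [: f] + [: g].
Proof. by rewrite !piE. Qed.

Lemma functions_on_piM (f g : Cinfty V) : [: f * g] = fo_mul [: f] [: g].
Proof. by apply/functions_onP => X OX; rewrite !mulX !reprE. Qed.

Lemma functions_on_piZ c (f : Cinfty V) : [: c *: f] = fo_scale c [: f].
Proof. by apply/functions_onP => X OX; rewrite !scaleX !reprE. Qed.

Let ind (P : Q -> Prop) : (forall f, P [: f]) -> forall u, P u.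
Proof. by move=> H u; rewrite -[u]reprK. Qed.

Let mulqA : associative fo_mul.
Proof.
by elim/ind=> f; elim/ind=> g; elim/ind=> h; rewrite -!functions_on_piM mulrA.
Qed.

Let mulqC : commutative fo_mul.
Proof. by elim/ind=> f; elim/ind=> g; rewrite -!functions_on_piM mulrC. Qed.

Let mul1q : left_id fo_one fo_mul.
Proof. by elim/ind=> f; rewrite -functions_on_piM mul1r. Qed.

Let mulqDl : left_distributive fo_mul +%R.
Proof.
elim/ind=> f; elim/ind=> g; elim/ind=> h.
by rewrite -piD -!functions_on_piM mulrDl piD.
Qed.

HB.instance Definition _ :=
  GRing.Zmodule_isComPzRing.Build Q mulqA mulqC mul1q mulqDl.

Let scaleqA a b u : fo_scale a (fo_scale b u) = fo_scale (a * b) u.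
Proof. by elim/ind: u => f; rewrite -!functions_on_piZ scalerA. Qed.

Let scale1q : left_id 1 fo_scale.
Proof. by elim/ind=> f; rewrite -!functions_on_piZ scale1r. Qed.

Let scaleqDr : right_distributive fo_scale +%R.
Proof.
move=> c; elim/ind=> f; elim/ind=> g.
by rewrite -piD -!functions_on_piZ scalerDr piD.
Qed.

Let scaleqDl u : {morph fo_scale^~ u : a b / a + b}.
Proof.
by move=> a b; elim/ind: u => f; rewrite -!functions_on_piZ scalerDl piD.
Qed.

HB.instance Definition _ :=
  GRing.Zmodule_isLmodule.Build K Q scaleqA scale1q scaleqDr scaleqDl.

End VanishingIdeal.

(* The library's algType excludes the zero ring, hence the explicit algebra
   axioms. *)
Record poisson_algebra (K : fieldType) (A : lmodType K)
    (mul : A -> A -> A) (one : A) (br : A -> A -> A) : Prop := {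
  pa_mulA : associative mul;
  pa_mulC : commutative mul;
  pa_mul1 : left_id one mul;
  pa_mul_linear : forall u, linear (mul u);
  pa_linearl : forall v, linear (br^~ v);
  pa_linearr : forall u, linear (br u);
  pa_alternating : forall u, br u u = 0;
  pa_jacobi : forall u v w, br u (br v w) + br v (br w u) + br w (br u v) = 0;
  pa_leibniz : forall u v w, br u (mul v w) = mul (br u v) w + mul v (br u w)
}.

(* A Z-graded finite-dimensional space is a space V with subspaces G i,
   i : int, almost all zero, of which V is the direct sum. *)
Definition is_grading (K : fieldType) (V : vectType K)
    (G : int -> {vspace V}) : Prop :=
  exists s : seq int,
    [/\ uniq s, forall i, i \notin s -> G i = 0%VS,
        directv (\sum_(i <- s) G i) & (\sum_(i <- s) G i)%VS = fullv].

(* A graded Lie bracket on (G i), given by its components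
   br i j : G i x G j -> G (i + j). *)
Record is_graded_lie (K : fieldType) (V : vectType K) (G : int -> {vspace V})
    (br : int -> int -> V -> V -> V) : Prop := {
  gl_deg : forall i j a b, a \in G i -> b \in G j -> br i j a b \in G (i + j);
  gl_linearl : forall i j c a a' b, a \in G i -> a' \in G i -> b \in G j ->
    br i j (c *: a + a') b = c *: br i j a b + br i j a' b;
  gl_linearr : forall i j c a b b', a \in G i -> b \in G j -> b' \in G j ->
    br i j a (c *: b + b') = c *: br i j a b + br i j a b';
  gl_antisym : forall i j a b, a \in G i -> b \in G j ->
    br i j a b = - ((-1) ^ (i * j) *: br j i b a);
  gl_jacobi : forall i j k a b c, a \in G i -> b \in G j -> c \in G k ->
    br i (j + k) a (br j k b c) =
    br (i + j) k (br i j a b) c + (-1) ^ (i * j) *: br j (i + k) b (br i k a c)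
}.

(* Finite-dimensional differential graded Lie algebras. *)
Record dgla (K : fieldType) := Dgla {
  dgla_car :> vectType K;
  dgla_gr : int -> {vspace dgla_car};
  dgla_d : 'End(dgla_car);
  dgla_br : dgla_car -> dgla_car -> dgla_car;
  dgla_grading : is_grading dgla_gr;
  dgla_d_deg : forall i a, a \in dgla_gr i -> dgla_d a \in dgla_gr (i + 1);
  dgla_dd : forall a, dgla_d (dgla_d a) = 0;
  dgla_br_linearl : forall b, linear (dgla_br^~ b);
  dgla_br_linearr : forall a, linear (dgla_br a);
  dgla_lie : is_graded_lie dgla_gr (fun _ _ => dgla_br);
  dgla_leibniz : forall i a b, a \in dgla_gr i ->
    dgla_d (dgla_br a b) =
    dgla_br (dgla_d a) b + (-1) ^ i *: dgla_br a (dgla_d b)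
}.

(* Finite-dimensional graded commutative algebras. In an MCP structure over a
   finite-dimensional dgla, the non-degeneracy of the pairings forces B to be
   finite-dimensional. *)
Record gcalg (K : fieldType) := Gcalg {
  gca_car :> vectType K;
  gca_gr : int -> {vspace gca_car};
  gca_mul : gca_car -> gca_car -> gca_car;
  gca_grading : is_grading gca_gr;
  gca_linearl : forall b, linear (gca_mul^~ b);
  gca_linearr : forall a, linear (gca_mul a);
  gca_deg : forall i j a b, a \in gca_gr i -> b \in gca_gr j ->
    gca_mul a b \in gca_gr (i + j);
  gca_mulA : associative gca_mul;
  gca_mulC : forall i j a b, a \in gca_gr i -> b \in gca_gr j ->
    gca_mul a b = (-1) ^ (i * j) *: gca_mul b a
}.

Section BV.
Variables (K : fieldType) (B : gcalg K) (delta : B -> B).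
Local Notation "a /^ b" := (gca_mul a b) (at level 40, left associativity).
Local Notation Bgr := (@gca_gr K B).

(* The bracket [a, b] for a homogeneous of degree p. *)
Definition bv_bracket (p : int) (a b : B) : B :=
  (-1) ^ p *: (delta (a /^ b) - delta a /^ b - (-1) ^ p *: (a /^ delta b)).

(* The degree shift by one: an element of shifted degree i lies in B^(i+1). *)
Record is_BV : Prop := {
  bv_linear : linear delta;
  bv_deg : forall i a, a \in Bgr i -> delta a \in Bgr (i - 1);
  bv_square : forall a, delta (delta a) = 0;
  bv_lie : is_graded_lie (fun i => Bgr (i + 1)) (fun i _ => bv_bracket (i + 1));
  bv_order2 : forall p q r a b c,
    a \in Bgr p -> b \in Bgr q -> c \in Bgr r ->
    delta (a /^ b /^ c) - delta (a /^ b) /^ c + delta a /^ b /^ c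
    - (-1) ^ p *: (a /^ delta (b /^ c))
    - (-1) ^ ((p + 1) * q) *: (b /^ delta (a /^ c))
    + (-1) ^ p *: (a /^ delta b /^ c)
    + (-1) ^ (p + q) *: (a /^ b /^ delta c) = 0
}.
End BV.

Section MaurerCartan.
Variables (K : numFieldType) (L : dgla K).
Local Notation Lgr := (@dgla_gr K L).
Local Notation d := (@dgla_d K L).
Local Notation "[: a , b ]" := (@dgla_br K L a b)
  (at level 0, format "[: a ,  b ]").

Definition L1 : vectType K := subvs_of (Lgr 1).

Definition twisted_d (X : L) (a : L) : L := d a + [: X, a].

Definition MC : set L1 :=
  [set X : L1 | d (vsval X) + 2^-1 *: [: vsval X, vsval X] = 0].

(* Y is the time-one value of the flow, started at X, of the vector field
   X |-> d lambda + [X, lambda]. Time ranges over K; over the complex numbers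
   this gives the same orbits as real time, L^0 being a complex space. *)
Definition gauge_flow (lambda : L) (X Y : L1) : Prop :=
  exists gamma : K -> L1,
    [/\ gamma 0 = X, gamma 1 = Y &
        forall t : K, is_derive t 1
          (fun s => v2r (vsval (gamma s)) : 'rV[K]_(dim L))
          (v2r (d lambda + [: vsval (gamma t), lambda]))].

Inductive gauge_orbit (X : L1) : set L1 :=
  | gauge_orbit_refl : gauge_orbit X X
  | gauge_orbit_step lambda Y Z : gauge_orbit X Y ->
      lambda \in Lgr 0 -> gauge_flow lambda Y Z -> gauge_orbit X Z.

Definition union_of_gauge_orbits (O : set L1) : Prop :=
  exists S : set L1, O = \bigcup_(X in S) gauge_orbit X.

End MaurerCartan.

Section MCP.
Variables (K : numFieldType) (L : dgla K) (B : gcalg K) (pair : L -> B -> K).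
Local Notation Lgr := (@dgla_gr K L).
Local Notation Bgr := (@gca_gr K B).
Local Notation "a /^ b" := (gca_mul a b) (at level 40, left associativity).
Local Notation "[: a , b ]" := (@dgla_br K L a b)
  (at level 0, format "[: a ,  b ]").

(* The pairings L^i x B^(i+1) -> K, extended by zero to a bilinear form on
   L x B. *)
Record is_pairing : Prop := {
  pair_linearl : forall b, scalar (pair^~ b);
  pair_linearr : forall a, scalar (pair a);
  pair_deg : forall i j a b, a \in Lgr i -> b \in Bgr j -> j != i + 1 ->
    pair a b = 0;
  pair_nondegl : forall i a, a \in Lgr i ->
    (forall b, b \in Bgr (i + 1) -> pair a b = 0) -> a = 0;
  pair_nondegr : forall i b, b \in Bgr (i + 1) ->
    (forall a, a \in Lgr i -> pair a b = 0) -> b = 0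
}.

(* The elements below defined through the pairing exist and are unique by
   non-degeneracy and finite-dimensionality. *)

(* (d_X a, b) = (a, delta_X b) *)
Definition adj_delta (X : L1 L) (b : B) : B :=
  xget 0 [set c : B | forall a : L,
    pair (twisted_d (vsval X) a) b = pair a c].

(* (X, a /\ b) = (rho_X a, b) *)
Definition rho (X : L1 L) (a : B) : L :=
  xget 0 [set l : L | l \in Lgr 0 /\
    forall b, b \in Bgr 1 -> pair (vsval X) (a /^ b) = pair l b].

Record is_MCP : Prop := {
  mcp_pairing : is_pairing;
  mcp_dX : forall X : L1 L, MC X -> twisted_d (vsval X) (vsval X) = 0;
  mcp_BV : forall X : L1 L, MC X -> is_BV (adj_delta X);
  mcp_rho : forall X : L1 L, MC X -> exists k : K,
    forall a b, a \in Bgr 1 -> b \in Bgr 1 ->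
      [: rho X a, rho X b] = k *: rho X (bv_bracket (adj_delta X) 1 a b)
}.

(* The differential Df(X), as the element of B^2 representing it. *)
Definition Dpair (f : L1 L -> K) (X : L1 L) : B :=
  xget 0 [set b : B | b \in Bgr 2 /\
    forall v : L1 L, dirD f X v = pair (vsval v) b].

Definition mcp_bracket (f g : L1 L -> K) (X : L1 L) : K :=
  pair (vsval X) (adj_delta X (Dpair f X) /^ adj_delta X (Dpair g X)).

End MCP.

(* Main.v *)
(** For [X] in MC(L) and [b] in B^2 put
    [ham X b = d_X (rho_X (delta_X b))]. Adjunction gives
    [{f, g}(X) = (ham X (Df), Dg)], the derivative of [g] at [X] along [ham X (Df)],
    and [ham X (Df)] is the gauge vector field of [rho_X (delta_X Df)] in L^0. The gauge
    fields are affine in [X], so their flows are given by an everywhere convergent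
    power series and stay in [O]; hence [{f, g}] vanishes on [O] as soon as [g] does.
    With antisymmetry this makes the bracket well defined on the quotient.

    In the Jacobi sum the second derivatives of the three functions cancel by
    Schwarz's theorem. Writing [a, b, c] for the images of the differentials under
    [delta_X], the rest is a multiple of the cyclic sum of
    [(X, a /\ delta_X (b /\ c))]. As [delta_X] has order two and kills [a, b, c],
    this sum is, up to sign, [(X, delta_X (a /\ b /\ c)) = (d_X X, a /\ b /\ c) = 0]. *)

Require Import Defs.
From HB Require Import structures.
From mathcomp Require Import all_boot all_order all_algebra generic_quotient.
From mathcomp Require Import complex.
From mathcomp Require Import all_classical all_reals all_analysis.
From mathcomp Require Import ring.

Set Implicit Arguments.
Unset Strict Implicit.
Unset Printing Implicit Defensive.

Import Order.TTheory GRing.Theory Num.Theory.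
Import numFieldNormedType.Exports VectorInternalTheory.

Local Open Scope classical_set_scope.
Local Open Scope ring_scope.
Local Open Scope quotient_scope.

(** * Schwarz's theorem over R and C *)

(** The increments [h] are quantified explicitly, so that a derivative over [R[i]] can be tested on
    real increments alone. *)
Lemma is_derive_epsP (K : numFieldType) (V W : normedModType K) (f : V -> W)
    (x v : V) (l : W) :
  is_derive x v f l <->
  forall e : K, 0 < e -> exists2 d : K, 0 < d & forall h : K, h != 0 ->
    `|h| < d -> `|l - h^-1 *: (f (h *: v + x) - f x)| < e.
Proof.
have E : is_derive x v f l <->
    (fun h => h^-1 *: ((f \o shift x) (h *: v) - f x)) @ 0^' --> l.
  split=> [[df <-]|fl]; first exact: df.
  split; first by apply/cvg_ex; exists l.
  by rewrite /derive; exact: cvg_lim.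
rewrite E; split=> [/cvgrPdist_lt fl e e0|fl].
  have := fl _ e0; rewrite near_withinE => /nbhs_ballP [d /= d0 H].
  exists d => // h h0 hd; apply: (H h) => //.
  by rewrite /ball /= sub0r normrN.
apply/cvgrPdist_lt => e e0; rewrite near_withinE.
have [d d0 H] := fl _ e0.
apply/nbhs_ballP; exists d => //= h; rewrite /ball /= sub0r normrN => hd h0.
exact: H.
Qed.

(** * From complex derivatives to real ones *)

Section ComplexReduction.
Variable R : realType.
Local Notation C := R[i].
Let K : numFieldType := R[i].

Lemma le_Re_norm (z : C) : (`|complex.Re z|)%:C%C <= `|z|.
Proof.
rewrite normc_def lecR -sqrtr_sqr ler_wsqrtr //.
by rewrite lerDl sqr_ge0.
Qed.

(** [c = 1] compares the real parts and [c = 'i] the imaginary parts. A complex identity is thus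
    reduced to identities between real functions. *)
Lemma Re_mul_inj (x y : C) :
  (forall c : C, complex.Re (c * x) = complex.Re (c * y)) -> x = y.
Proof.
move=> H; apply/eqP; rewrite eq_complex.
have := H 1; rewrite !mul1r => ->; rewrite eqxx /=.
have := H 'i%C; rewrite !(mulrC 'i%C) !ReiNIm => /oppr_inj ->.
by rewrite eqxx.
Qed.

Lemma Re_is_derive (c : C) (f : K -> K) (r : R) (l : C) :
  is_derive (r%:C%C : K) 1 f (l : K) ->
  is_derive r 1 (fun s : R => complex.Re (c * f s%:C%C)) (complex.Re (c * l)).
Proof.
move=> fl.
have : is_derive (r%:C%C : K) 1 ((c : K) *: f) ((c : K) *: (l : K)).
  exact: is_deriveZ.
move=> /is_derive_epsP H; apply/is_derive_epsP => e e0.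
have [|[d di]] := H e%:C%C; first by rewrite ltcR.
(* A positive element of [R[i]] has zero imaginary part, so the radius is a real number. *)
rewrite ltcE /= => /andP [/eqP -> d0] {}H; exists d => // h h0 hd.
have hC : (h%:C%C != 0 :> C).
  by rewrite -(rmorph0 (real_complex R)) (inj_eq (@complexI R)).
have hCd : `|h%:C%C : C| < d%:C%C.
  by rewrite normc_def /= expr0n addr0 sqrtr_sqr ltcR.
have := H _ hC hCd; rewrite -ltcR; apply: le_lt_trans.
apply: le_trans (le_Re_norm _); rewrite lecR.
rewrite le_eqVlt; apply/orP; left; apply/eqP; congr (`|_|).
rewrite -[c *: f]/(fun x => c * f x) /=.
have ReB (x y : C) : complex.Re (x - y) = complex.Re x - complex.Re y.
  by case: x y => ? ? [].
have ReZ (k : R) (x : C) : complex.Re (k%:C%C * x) = k * complex.Re x.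
  by case: x => ? ? /=; rewrite mul0r subr0.
rewrite -[c *: l]/(c * l) -[_^-1 *: (_ - _) in RHS]/(_^-1 * (_ - _)).
rewrite -[h%:C%C%:A]/(h%:C%C * 1) -[h%:A]/(h * 1) !mulr1 -rmorphD.
by rewrite ReB -fmorphV ReZ ReB.
Qed.

End ComplexReduction.

(** * Symmetry of mixed derivatives in two variables *)

Section Schwarz.

Definition continuous_at0 (K : numFieldType) (G : K -> K -> K) : Prop :=
  forall e : K, 0 < e -> exists2 d : K, 0 < d &
    forall s t, `|s| < d -> `|t| < d -> `|G s t - G 0 0| < e.

(** The mean value theorem is applied twice: in [s] to [G s h - G s 0], then in [t] to [G1 s] at the
    point [s] just found. *)
Lemma mixed_difference (R : realType) (G G1 G12 : R -> R -> R) (h : R) :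
  0 < h ->
  (forall s t : R, is_derive s 1 (G^~ t) (G1 s t)) ->
  (forall s t : R, is_derive t 1 (G1 s) (G12 s t)) ->
  exists s t, [/\ 0 < s < h, 0 < t < h &
    G h h - G h 0 - (G 0 h - G 0 0) = h * h * G12 s t].
Proof.
move=> h0 dG dG1.
pose phi s := G s h - G s 0; pose dphi s := G1 s h - G1 s 0.
have dphiP (s : R) : is_derive s 1 phi (dphi s) by exact: is_deriveB.
have cont (u : R -> R) (du : R -> R) : (forall s : R, is_derive s 1 u (du s)) ->
    {within `[0, h], continuous u}.
  move=> H; apply: derivable_within_continuous => x _.
  by have := H x; case.
have [s] := MVT h0 (fun s _ => dphiP s) (cont _ _ dphiP).
rewrite in_itv /= => hs E1.
have [t] := MVT h0 (fun t _ => dG1 s t) (cont _ _ (dG1 s)).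
rewrite in_itv /= => ht E2.
exists s, t; split=> //; rewrite -[LHS]/(phi h - phi 0) E1 /dphi E2.
by rewrite subr0 mulrC mulrA mulrAC.
Qed.

(** The second difference of [G] over the square with side [h] does not depend on the order of the
    variables. Divided by [h * h], it is a value of [G12] and also a value of [G21], both at points
    that tend to the origin with [h]. *)
Lemma schwarz_real (R : realType) (G G1 G2 G12 G21 : R -> R -> R) :
  (forall s t : R, is_derive s 1 (G^~ t) (G1 s t)) ->
  (forall s t : R, is_derive t 1 (G s) (G2 s t)) ->
  (forall s t : R, is_derive t 1 (G1 s) (G12 s t)) ->
  (forall s t : R, is_derive s 1 (G2^~ t) (G21 s t)) ->
  continuous_at0 G12 -> continuous_at0 G21 -> G12 0 0 = G21 0 0.
Proof.
move=> dG1 dG2 dG12 dG21 c12 c21; apply/eqP; rewrite -subr_eq0 -normr_le0.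
apply/ler_addgt0Pr => e e0; rewrite add0r.
have e20 : 0 < e / 2 by rewrite divr_gt0.
have [d d0 H] := c12 _ e20; have [d' d'0 H'] := c21 _ e20.
pose h := Num.min d d'.
have h0 : 0 < h by rewrite lt_min d0.
have [hd hd'] : h <= d /\ h <= d' by rewrite !ge_min !lexx orbT.
have [s [t [/andP[s0 sh] /andP[t0 th] E]]] := mixed_difference h0 dG1 dG12.
have [t' [s' [/andP[t'0 t'h] /andP[s'0 s'h] E']]] :=
  @mixed_difference _ (fun t s => G s t) (fun t s => G2 s t)
    (fun t s => G21 s t) h h0 (fun t s => dG2 s t) (fun t s => dG21 s t).
have hh : h * h != 0 by rewrite mulf_neq0 // gt_eqF.
have EE : G12 s t = G21 s' t' by apply: (mulfI hh); rewrite -E -E'; ring.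
have lt_norm x : 0 < x -> x < h -> `|x| < d /\ `|x| < d'.
  by move=> x0 xh; rewrite gtr0_norm //; split; exact: lt_le_trans xh _.
have [sd _] := lt_norm _ s0 sh; have [td _] := lt_norm _ t0 th.
have [_ sd'] := lt_norm _ s'0 s'h; have [_ td'] := lt_norm _ t'0 t'h.
have A := H _ _ sd td; have A' := H' _ _ sd' td'.
have -> : G12 0 0 - G21 0 0 = - (G12 s t - G12 0 0) + (G21 s' t' - G21 0 0).
  by rewrite EE; ring.
apply: le_trans (ler_normD _ _) _; rewrite normrN.
by apply: ltW; rewrite [e]splitr ltrD.
Qed.

(* Over C, the real case applies to Re (c G) on R x R for every constant c. *)
Lemma schwarz_plane (K : numFieldType) (G G1 G2 G12 G21 : K -> K -> K) :
  real_or_complex K ->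
  (forall s t : K, is_derive s 1 (G^~ t) (G1 s t)) ->
  (forall s t : K, is_derive t 1 (G s) (G2 s t)) ->
  (forall s t : K, is_derive t 1 (G1 s) (G12 s t)) ->
  (forall s t : K, is_derive s 1 (G2^~ t) (G21 s t)) ->
  continuous_at0 G12 -> continuous_at0 G21 -> G12 0 0 = G21 0 0.
Proof.
move=> KRC; case: KRC G G1 G2 G12 G21 => R G G1 G2 G12 G21.
  exact: schwarz_real.
move=> dG1 dG2 dG12 dG21 c12 c21; apply: Re_mul_inj => c.
pose r (F : R[i] -> R[i] -> R[i]) (s t : R) := complex.Re (c * F s%:C%C t%:C%C).
have cr (F : R[i] -> R[i] -> R[i]) : @continuous_at0 R[i] F ->
    continuous_at0 (r F).
  (* The summand 1 keeps [k] positive when [c = 0]; in all cases [|c| <= k]. *)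
  move=> cF e e0; pose k := complex.Re `|c| + 1.
  have k0 : 0 < k.
    by apply: ltr_wpDl; rewrite ?ltr01 // -ler0c RRe_real ?normr_real.
  have ek0 : 0 < (e / k)%:C%C :> R[i] by rewrite ltcR divr_gt0.
  have [[d di]] := cF _ ek0.
  rewrite ltcE /= => /andP [/eqP -> d0] {}H; exists d => // s t hs ht.
  have nC (x : R) : `|x| < d -> `|x%:C%C : R[i]| < d%:C%C.
    by rewrite normc_def /= expr0n addr0 sqrtr_sqr ltcR.
  have := H _ _ (nC _ hs) (nC _ ht).
  set z := F _ _ - _ => zlt.
  have -> : r F s t - r F 0 0 = complex.Re (c * z).
    rewrite /r -raddfB -mulrBr //.
  rewrite -ltcR; apply: le_lt_trans (le_Re_norm _) _.
  rewrite normrM.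
  have -> : e%:C%C = k%:C%C * (e / k)%:C%C :> R[i].
    by rewrite -rmorphM mulrCA divff ?mulr1 // gt_eqF.
  apply: le_lt_trans (_ : k%:C%C * `|z| < _).
    by rewrite ler_wpM2r // -[`|c|]RRe_real ?normr_real // lecR /k lerDl.
  by rewrite ltr_pM2l // ltcR.
apply: (@schwarz_real R (r G) (r G1) (r G2) (r G12) (r G21)).
- by move=> s t; exact: (@Re_is_derive R c (G^~ t%:C%C)).
- by move=> s t; exact: (@Re_is_derive R c (G s%:C%C)).
- by move=> s t; exact: (@Re_is_derive R c (G1 s%:C%C)).
- by move=> s t; exact: (@Re_is_derive R c (G2^~ t%:C%C)).
- exact: cr.
- exact: cr.
Qed.

End Schwarz.

(** * Exponential generating series and affine flows *)

Lemma abs_convergent_real (R : realType) (u : nat -> R) (B : R) :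
  (forall n, \sum_(0 <= i < n) `|u i| <= B) -> cvgn (series u).
Proof.
move=> uB; apply: normed_cvg; apply: nondecreasing_is_cvgn.
  by apply: nondecreasing_series => n _ _ /=.
by exists B => _ [n _ <-]; exact: uB.
Qed.

(** Over [R[i]] the series of real parts and of imaginary parts satisfy the same bound, and their
    limits are reassembled. *)
Lemma abs_convergent (K : numFieldType) (u : nat -> K) (B : K) :
  real_or_complex K ->
  (forall n, \sum_(0 <= i < n) `|u i| <= B) -> cvgn (series u).
Proof.
move=> KRC; case: KRC u B => R u B uB; first exact: abs_convergent_real uB.
pose x n := complex.Re (u n); pose y n := complex.Im (u n).
(* The empty sum gives [0 <= B], and nonnegative complex numbers are real. *)
have B0 : B \is Num.real.
  by apply: ger0_real; have := uB 0%N; rewrite big_geq.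
have ni : `|'i%C : R[i]| = 1 by rewrite normc_def /= expr0n expr1n add0r sqrtr1.
have bnd (z : nat -> R) : (forall n, (`|z n|)%:C%C <= `|u n|) -> cvgn (series z).
  move=> zu; apply: (@abs_convergent_real _ _ (complex.Re B)) => n.
  rewrite -lecR (RRe_real B0); apply: le_trans (uB n).
  by rewrite rmorph_sum /=; apply: ler_sum => i _; exact: zu.
have /cvg_ex [a xa] : cvgn (series x) by apply: bnd => n; exact: le_Re_norm.
have /cvg_ex [b yb] : cvgn (series y).
  apply: bnd => n; rewrite -normrN /y -ReiNIm; apply: le_trans (le_Re_norm _) _.
  by rewrite normrM ni mulr1.
have E n : series u n = (series x n +i* series y n)%C.
  elim: n => [|n IH]; first by rewrite /series /= !big_geq.
  by rewrite !seriesSr IH /x /y; case: (u n).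
apply/cvg_ex; exists (a +i* b : R[i])%C; apply/cvgrPdist_lt => -[e ei].
rewrite ltcE /= => /andP [/eqP -> e0].
have e20 : 0 < e / 2 by rewrite divr_gt0.
have key (p q : R) : `|p| < e / 2 -> `|q| < e / 2 ->
    `|p%:C%C + 'i%C * q%:C%C : R[i]| < e%:C%C.
  move=> pe qe; have H := ler_normD (p%:C%C : R[i]) ('i%C * q%:C%C).
  apply: (le_lt_trans H).
  rewrite normrM ni mul1r !normc_def /= !expr0n /= !addr0 !sqrtr_sqr.
  by rewrite -rmorphD ltcR [e]splitr ltrD.
move/cvgrPdist_lt/(_ _ e20) : xa; move/cvgrPdist_lt/(_ _ e20) : yb.
move=> yn xn; near=> n; rewrite E.
have yd : `|b - series y n| < e / 2 by near: n.
have xd : `|a - series x n| < e / 2 by near: n.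
have -> : (a +i* b)%C - (series x n +i* series y n)%C =
    (a - series x n)%:C%C + 'i%C * (b - series y n)%:C%C :> R[i].
  by rewrite [LHS]complexE.
exact: key.
Unshelve. all: by end_near.
Qed.

(** Over R the bound is [expR T]; over [R[i]] a nonnegative [T] is real. All convergence estimates
    below compare with this series. *)
Lemma exp_partial_sums_bounded (K : numFieldType) (T : K) :
  real_or_complex K -> 0 <= T ->
  exists B : K, forall n, \sum_(0 <= i < n) T ^+ i / i`!%:R <= B.
Proof.
have real (R : realType) (t : R) : 0 <= t ->
    exists B : R, forall n, \sum_(0 <= i < n) t ^+ i / i`!%:R <= B.
  move=> t0; exists (expR t) => n.
  apply: nondecreasing_cvgn_le; last exact: is_cvg_series_exp_coeff.
  by apply: nondecreasing_series => i _ _; rewrite divr_ge0 ?exprn_ge0 // ler0n.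
move=> KRC; case: KRC T => R T T0; first exact: real.
have TE := RRe_real (ger0_real T0).
have [|B HB] := real R (complex.Re T); first by rewrite -ler0c TE.
exists B%:C%C => n; rewrite -TE.
have -> : \sum_(0 <= i < n) (complex.Re T)%:C%C ^+ i / i`!%:R =
    (\sum_(0 <= i < n) (complex.Re T) ^+ i / i`!%:R)%:C%C :> R[i].
  rewrite rmorph_sum; apply: eq_bigr => i _.
  by rewrite rmorphM rmorphXn fmorphV rmorph_nat.
by rewrite lecR.
Qed.

(** * Convergence and termwise differentiation of exponential generating functions *)

Section ExponentialSeries.
Variable K : numFieldType.
Hypothesis KRC : real_or_complex K.

(** The factor [n!] in the denominator makes differentiation a shift of the coefficient sequence,
    which turns a linear differential equation into a recursion. *)
Definition egf_term (a : nat -> K) (t : K) (n : nat) : K :=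
  a n * t ^+ n / n`!%:R.

(* Junk value of [limn] when the series diverges. *)
Definition egf (a : nat -> K) (t : K) : K := limn (series (egf_term a t)).

(** This growth is that of the coordinates of the iterates of a linear map, and it makes the series
    converge for every [t]. *)
Definition geometrically_bounded (a : nat -> K) : Prop :=
  exists C M : K, [/\ 0 <= C, 0 <= M & forall n, `|a n| <= C * M ^+ n].

Lemma geometrically_bounded_shift a :
  geometrically_bounded a -> geometrically_bounded (fun n => a n.+1).
Proof.
move=> [C [M [C0 M0 H]]]; exists (C * M), M; split=> //; first exact: mulr_ge0.
by move=> n; rewrite -mulrA -exprS.
Qed.

Lemma fact_gt0R n : 0 < n`!%:R :> K.
Proof. by rewrite ltr0n fact_gt0. Qed.

Lemma egf_cvg a t : geometrically_bounded a -> cvgn (series (egf_term a t)).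
Proof.
move=> [C [M [C0 M0 H]]].
have [B HB] := exp_partial_sums_bounded KRC (mulr_ge0 M0 (normr_ge0 t)).
apply: (@abs_convergent _ _ (C * B)) => // n.
apply: le_trans (_ : C * \sum_(0 <= i < n) (M * `|t|) ^+ i / i`!%:R <= _); last first.
  exact: ler_wpM2l.
rewrite mulr_sumr; apply: ler_sum => i _.
rewrite /egf_term !normrM normfV normrX (gtr0_norm (fact_gt0R i)) exprMn !mulrA.
by rewrite ler_wpM2r ?invr_ge0 ?ler0n // ler_wpM2r ?exprn_ge0.
Qed.

Lemma egf_linear k a b t :
  geometrically_bounded a -> geometrically_bounded b ->
  egf (fun n => k * a n + b n) t = k * egf a t + egf b t.
Proof.
move=> /(@egf_cvg _ t) ca /(@egf_cvg _ t) cb; apply: cvg_lim => //.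
have -> : series (egf_term (fun n => k * a n + b n) t) =
    (fun n => k * series (egf_term a t) n + series (egf_term b t) n).
  apply/funext => n; rewrite /series /= mulr_sumr -big_split.
  by apply: eq_bigr => i _; rewrite /egf_term !mulrDl !mulrA.
by apply: cvgD => //; apply: cvgMr.
Qed.

Lemma egf0 a : egf a 0 = a 0%N.
Proof.
apply: cvg_lim => //; apply: cvg_near_cst; exists 1%N => // n /= n1.
rewrite /series /= big_ltn // big1_seq => [|i /andP [_]].
  by rewrite /egf_term expr0 divr1 mulr1 addr0.
rewrite mem_index_iota /egf_term => /andP [i1 _].
by rewrite expr0n gtn_eqF // mulr0 mul0r.
Qed.

(** Induction on [n]: the remainder at [n.+1] is [t + h] times the one at [n], plus
    [h ^+ 2 * (n%:R * t ^+ n.-1)]. Each part is at most half of the new bound, since [n <= 2 ^ n]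
    and [1 <= T]. *)
Lemma power_taylor_bound (t h T : K) n : 1 <= T -> `|t| <= T -> `|t + h| <= T ->
  `|(t + h) ^+ n - t ^+ n - n%:R * h * t ^+ n.-1| <= `|h| ^+ 2 * (2 * T) ^+ n.
Proof.
move=> T1 tT thT; have T0 : 0 <= T by rewrite (le_trans _ T1).
elim: n => [|n IH]; first by rewrite subrr !mul0r subr0 normr0 mulr1 exprn_ge0.
have -> : (t + h) ^+ n.+1 - t ^+ n.+1 - n.+1%:R * h * t ^+ n.+1.-1 =
    (t + h) * ((t + h) ^+ n - t ^+ n - n%:R * h * t ^+ n.-1) +
    h ^+ 2 * (n%:R * t ^+ n.-1).
  case: n {IH} => [|n] /=; first by ring.
  by rewrite !exprS -[n.+2]addn2 -[n.+1]addn1 !natrD; ring.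
apply: le_trans (ler_normD _ _) _.
have nT : `|n%:R * t ^+ n.-1| <= T * (2 * T) ^+ n.
  rewrite normrM normr_nat normrX exprMn mulrCA.
  apply: ler_pM; rewrite ?ler0n ?exprn_ge0 //.
    by rewrite -natrX ler_nat ltnW // ltn_expl.
  rewrite -exprS; apply: le_trans (_ : T ^+ n.-1 <= _).
    by rewrite lerXn2r // nnegrE.
  by rewrite ler_weXn2l // -subn1 (leq_trans (leq_subr _ _)).
have -> : `|h| ^+ 2 * (2 * T) ^+ n.+1 =
    T * (`|h| ^+ 2 * (2 * T) ^+ n) + `|h| ^+ 2 * (T * (2 * T) ^+ n).
  by rewrite [(2 * T) ^+ n.+1]exprS; ring.
apply: lerD; rewrite normrM; first exact: ler_pM.
by rewrite normrX ler_wpM2l ?exprn_ge0.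
Qed.

Lemma lim_norm_le (x : nat -> K) (l b : K) :
  x @ \oo --> l -> (forall n, `|x n| <= b) -> `|l| <= b.
Proof.
move=> xl xb; have b0 : 0 <= b by rewrite (le_trans _ (xb 0%N)).
rewrite real_leNgt ?ger0_real //; apply/negP => bl.
have e0 : 0 < `|l| - b by rewrite subr_gt0.
move/cvgrPdist_lt/(_ _ e0) : xl => -[N _ /(_ N (leqnn N)) /= lN].
have := ler_normD (l - x N) (x N); rewrite subrK => /le_lt_trans.
by move=> /(_ _ (ltr_leD lN (xb N))); rewrite subrK ltxx.
Qed.

(** Summing [power_taylor_bound] against the coefficients bounds the first-order remainder by a
    constant times [|h| ^+ 2], uniformly for [|h| <= 1]. *)
Lemma egf_derive a (t : K) : geometrically_bounded a ->
  is_derive t 1 (egf a) (egf (fun n => a n.+1) t).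
Proof.
move=> Ha; have [C [M [C0 M0 H]]] := Ha.
pose T := `|t| + 1; have T1 : 1 <= T by rewrite lerDr.
have T0 : 0 <= T by rewrite (le_trans _ T1).
have MT0 : 0 <= M * (2 * T) by rewrite !mulr_ge0.
have [B HB] := exp_partial_sums_bounded KRC MT0.
have key (h : K) : `|h| <= 1 ->
    `|egf a (t + h) - egf a t - h * egf (fun n => a n.+1) t| <= `|h| ^+ 2 * (C * B).
  move=> h1; pose x n := \sum_(0 <= i < n) a i / i`!%:R *
      ((t + h) ^+ i - t ^+ i - i%:R * h * t ^+ i.-1).
  apply: (@lim_norm_le (fun n => x n.+1)) => [|n].
    (* The derivative series has one term fewer, because the constant term of [egf a] contributes
       nothing. *)
    have xE n : x n.+1 = series (egf_term a (t + h)) n.+1 -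
        series (egf_term a t) n.+1 - h * series (egf_term (fun n => a n.+1) t) n.
      elim: n => [|n IH].
        rewrite /x /series /= !big_nat1 big_geq // /egf_term !expr0.
        by ring.
      rewrite /x big_nat_recr // -/(x n.+1) IH !seriesSr /egf_term /= factS natrM.
      by field; rewrite !gt_eqF ?fact_gt0R ?ltr0n.
    under eq_fun do rewrite xE.
    have c (b : nat -> K) s : geometrically_bounded b ->
        series (egf_term b s) @ \oo --> egf b s by move=> /(@egf_cvg _ s).
    apply: cvgB; last first.
      by apply: cvgMl_tmp; apply: c; exact: geometrically_bounded_shift.
    by apply: cvgB; rewrite cvg_shiftS; exact: c.
  rewrite /x; apply: le_trans (ler_norm_sum _ _ _) _.
  apply: le_trans (_ : `|h| ^+ 2 *
      (C * \sum_(0 <= i < n.+1) (M * (2 * T)) ^+ i / i`!%:R) <= _); last first.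
    by rewrite ler_wpM2l ?exprn_ge0 // ler_wpM2l.
  rewrite !mulr_sumr; apply: ler_sum => i _.
  rewrite normrM normrM normfV (gtr0_norm (fact_gt0R i)).
  have -> : `|h| ^+ 2 * (C * ((M * (2 * T)) ^+ i / i`!%:R)) =
      (C * M ^+ i / i`!%:R) * (`|h| ^+ 2 * (2 * T) ^+ i).
    by rewrite exprMn; ring.
  apply: ler_pM; rewrite ?mulr_ge0 ?invr_ge0 ?ler0n //.
    by rewrite ler_wpM2r ?invr_ge0 ?ler0n.
  apply: power_taylor_bound => //; first by rewrite lerDl.
  by apply: le_trans (ler_normD _ _) _; rewrite lerD2l.
apply/is_derive_epsP => e e0.
have CB0 : 0 <= C * B.
  by rewrite mulr_ge0 //; have := HB 0%N; rewrite big_geq.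
have CB1 : 0 < C * B + 1 by rewrite ltr_wpDl.
(* The radius [(1 + q)^-1] is at most 1, as [key] requires, and at most [e / (C * B + 1)]. The
   summand 1 covers the case [C * B = 0]. *)
pose q := (C * B + 1) / e; have q0 : 0 < q by rewrite divr_gt0.
exists (1 + q)^-1 => [|h h0 hd]; first by rewrite invr_gt0 addr_gt0.
have h1 : `|h| <= 1.
  by apply: ltW; apply: lt_le_trans hd _; rewrite invf_le1 ?addr_gt0 // lerDl ltW.
have he : `|h| * (C * B) < e.
  apply: le_lt_trans (_ : `|h| * (C * B + 1) < _).
    by rewrite ler_wpM2l // lerDl.
  rewrite -ltr_pdivlMr //; apply: lt_le_trans hd _.
  rewrite -[e / _]invrK invf_div lef_pV2 ?posrE ?addr_gt0 //.
  by rewrite -/q lerDr.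
rewrite -[h *: 1]/(h * 1) mulr1 -[_ *: _]/(_ * _).
have := key h h1; rewrite (addrC t h).
set u := egf a _; set v := egf a _; set w := egf _ _ => kh.
have -> : w - h^-1 * (u - v) = - h^-1 * (u - v - h * w) by field.
rewrite normrM normrN normfV; apply: le_lt_trans he.
by rewrite ler_pdivrMl ?normr_gt0 // mulrA -expr2.
Qed.

End ExponentialSeries.

(** * Solution of affine differential equations on a finite-dimensional space *)

Section LinearFlow.
Variable K : numFieldType.
Hypothesis KRC : real_or_complex K.

Lemma is_derive_scalel (W : normedModType K) (k : K -> K) (t l : K) (w : W) :
  is_derive t 1 k l -> is_derive t 1 (fun s => k s *: w) (l *: w).
Proof.
move=> dk; have dk' : differentiable k t by apply/derivable1_diffP; case: dk.
have dkw := differentiableZl w dk'.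
apply: DeriveDef; first exact: diff_derivable.
by rewrite deriveE // diffZl // -deriveE //; case: dk => _ ->.
Qed.

Lemma geometrically_bounded_linear k (a b : nat -> K) :
  geometrically_bounded a -> geometrically_bounded b ->
  geometrically_bounded (fun n => k * a n + b n).
Proof.
move=> [C [M [C0 M0 H]]] [D [N [D0 N0 H']]].
exists (`|k| * C + D), (M + N); split; rewrite ?addr_ge0 ?mulr_ge0 // => n.
apply: le_trans (ler_normD _ _) _; rewrite normrM mulrDl -mulrA.
by apply: lerD; [apply: ler_wpM2l => //|];
  apply: le_trans (H n) _ || apply: le_trans (H' n) _;
  apply: ler_wpM2l => //; rewrite lerXn2r ?nnegrE ?addr_ge0 // ?lerDl ?lerDr.
Qed.

Lemma geometrically_bounded0 : geometrically_bounded (fun=> 0 : K).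
Proof. by exists 0, 0; split=> // n; rewrite normr0 mul0r. Qed.

Lemma egf_finitely_supported (a : nat -> K) t :
  (forall n, a n.+1 = 0) -> egf a t = a 0%N.
Proof.
move=> a0; apply: cvg_lim => //; apply: cvg_near_cst; exists 1%N => // n /= n1.
rewrite /series /= big_ltn // big1_seq => [|i /andP [_]].
  by rewrite /egf_term expr0 divr1 mulr1 addr0.
by rewrite mem_index_iota /egf_term; case: i => // i _; rewrite a0 !mul0r.
Qed.

Lemma egf_sum (I : Type) (r : seq I) (k : I -> K) (a : I -> nat -> K) t :
  (forall i, geometrically_bounded (a i)) ->
  geometrically_bounded (fun n => \sum_(i <- r) k i * a i n) /\
  egf (fun n => \sum_(i <- r) k i * a i n) t = \sum_(i <- r) k i * egf (a i) t.
Proof.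
move=> Ha; elim: r => [|i r [IHb IHe]].
  under eq_fun do rewrite big_nil.
  by split; [exact: geometrically_bounded0|rewrite big_nil egf_finitely_supported].
under eq_fun do rewrite big_cons.
split; first exact: geometrically_bounded_linear.
by rewrite egf_linear // IHe big_cons.
Qed.

Variables (V : vectType K) (A : {linear V -> V}).
Let d := \dim {:V}.
Let e := vbasis {:V}.
Let co i x := coord e i x.

Let coE x : x = \sum_(i < d) co i x *: e`_i.
Proof. by apply: coord_vbasis; exact: memvf. Qed.

Let coA i x : co i (A x) = \sum_(j < d) co i (A e`_j) * co j x.
Proof.
rewrite [X in A X]coE linear_sum /co linear_sum; apply: eq_bigr => j _.
by rewrite linearZ /= linearZ mulrC.
Qed.

(** In the l1 norm of the coordinates, [A] expands by at most the sum [Q] of the absolute values of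
    its matrix entries; [S n] is that norm for the n-th iterate. *)
Lemma geometrically_bounded_iter v i :
  geometrically_bounded (fun n => co i (iter n A v)).
Proof.
pose Q := \sum_(i < d) \sum_(j < d) `|co i (A e`_j)|.
pose S n := \sum_(i < d) `|co i (iter n A v)|.
have le_sum (J : finType) (F : J -> K) j :
    (forall j, 0 <= F j) -> F j <= \sum_j F j.
  by move=> F0; rewrite (bigD1 j) //= lerDl sumr_ge0.
have Q0 : 0 <= Q by apply: sumr_ge0 => ? _; apply: sumr_ge0.
have S0 n : 0 <= S n by apply: sumr_ge0.
exists (S 0%N), Q; split=> // n.
apply: le_trans (_ : S n <= _); first by apply: le_sum => j.
elim: n => [|n IH]; first by rewrite mulr1.
rewrite exprS mulrCA; apply: le_trans (_ : Q * S n <= _); last exact: ler_wpM2l.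
rewrite /S /Q mulr_suml; apply: ler_sum => j _ /=; rewrite coA mulr_suml.
apply: le_trans (ler_norm_sum _ _ _) _; apply: ler_sum => k _.
by rewrite normrM ler_wpM2l //; apply: le_sum.
Qed.

(* The solution is x0 + \sum_n t^(n+1) / (n+1)! A^n v. *)
Lemma affine_flow (x0 v : V) : exists2 g : K -> V, g 0 = x0 &
  forall (W : normedModType K) (f : {linear V -> W}) (t : K),
    is_derive t 1 (fun s => f (g s)) (f (v + A (g t - x0))).
Proof.
pose a i n := co i (iter n A v).
(* Prepending 0 to [a i] gives a primitive that vanishes at time 0: the derivative of [egf (b i)] is
   [egf (a i)]. *)
pose b i n := if n is n'.+1 then a i n' else 0.
have ab i : geometrically_bounded (a i) by exact: geometrically_bounded_iter.
have bb i : geometrically_bounded (b i).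
  have [C [M [C0 M0 H]]] := ab i.
  exists (C + C), (M + 1); split; rewrite ?addr_ge0 // => -[|n] /=.
    by rewrite normr0 mulr1 addr_ge0.
  apply: le_trans (H n) _; apply: ler_pM; rewrite ?exprn_ge0 ?lerDl //.
  apply: le_trans (_ : (M + 1) ^+ n <= _).
    by rewrite lerXn2r ?nnegrE ?addr_ge0 // lerDl.
  by rewrite exprS ler_peMl ?exprn_ge0 ?addr_ge0 // lerDr.
pose g t := x0 + \sum_(i < d) egf (b i) t *: e`_i.
exists g => [|W f t].
  by rewrite /g big1 ?addr0 // => i _; rewrite egf0 /= scale0r.
(* This is the differential equation read on coefficients: [a] is [v] at index 0, and [A] applied to
   [b] at every later index. *)
have aE i : egf (a i) t = co i v + \sum_(j < d) co i (A e`_j) * egf (b j) t.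
  have [sb <-] := egf_sum (index_enum _) (fun j : 'I_d => co i (A e`_j)) t bb.
  have db : geometrically_bounded (fun n => (n == 0%N)%:R : K).
    exists 1, 1; split=> // n; rewrite expr1n mulr1 normr_nat.
    by case: (n == 0%N); rewrite ?ler01.
  rewrite -[co i v]mulr1.
  have -> : 1 = egf (fun n => (n == 0%N)%:R) t :> K by rewrite egf_finitely_supported.
  rewrite -egf_linear //; congr egf; apply/funext => -[|n] /=.
    by rewrite mulr1 big1 ?addr0 // => j _; rewrite mulr0.
  by rewrite mulr0 add0r /a iterS coA.
have -> : v + A (g t - x0) = \sum_(i < d) egf (a i) t *: e`_i.
  rewrite [LHS]coE; apply: eq_bigr => i _; congr (_ *: _).
  rewrite aE /co linearD /=; congr (_ + _); rewrite -/(co _ _) coA.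
  apply: eq_bigr => j _; congr (_ * _).
  rewrite /g addrC addKr /co linear_sum /= (bigD1 j) //= linearZ /=.
  rewrite coord_free ?(basis_free (vbasisP _)) // eqxx mulr1.
  rewrite big1 ?addr0 // => l lj; rewrite linearZ /=.
  by rewrite coord_free ?(basis_free (vbasisP _)) // (negbTE lj) mulr0.
(* [V] carries no norm, so the derivative is taken after a linear map [f] into a normed space. *)
have -> : (fun s => f (g s)) =
    cst (f x0) + \sum_(i < d) (fun s : K => egf (b i) s *: f e`_i).
  apply/funext => s; rewrite /g linearD linear_sum /=.
  rewrite -[RHS]/(f x0 + (\sum_(i < d) (fun s : K => egf (b i) s *: f e`_i)) s).
  by rewrite fct_sumE; congr (_ + _); apply: eq_bigr => i _; rewrite linearZ.
have H : is_derive t 1 (\sum_(i < d) (fun s : K => egf (b i) s *: f e`_i))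
    (\sum_(i < d) f (egf (a i) t *: e`_i)).
  apply: is_derive_sum => i; rewrite linearZ /=; apply: is_derive_scalel.
  exact: (@egf_derive K KRC (b i) t (bb i)).
have := is_deriveD (is_derive_cst (f x0) t 1) H.
by rewrite add0r linear_sum.
Qed.

End LinearFlow.

(** * Directional derivatives on a finite-dimensional space *)

Section DirectionalDerivative.
Variable K : numFieldType.

Lemma is_derive_curve (U W : normedModType K) (F : U -> W) (c : K -> U) (t : K)
    (w : U) :
  differentiable F (c t) -> is_derive t 1 c w ->
  is_derive t 1 (F \o c) ('D_w F (c t)).
Proof.
move=> dF dc; have dc' : differentiable c t by apply/derivable1_diffP; case: dc.
have dFc := differentiable_comp dc' dF.
apply: DeriveDef; first exact: diff_derivable.
have <- : 'd c t 1 = w by rewrite -deriveE //; case: dc.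
by rewrite deriveE // diff_comp //= deriveE.
Qed.

(** [F] is restricted to the plane [x + s *: a + t *: b], where directional derivatives become
    partial derivatives. *)
Lemma Ck_derive_sym m (F : 'rV[K]_m -> K) (x a b : 'rV[K]_m) :
  real_or_complex K -> Ck 2 F ->
  'D_b (fun y => 'D_a F y) x = 'D_a (fun y => 'D_b F y) x.
Proof.
move=> KRC [dF CF].
pose p s t := x + s *: a + t *: b.
have dp1 (s t : K) : is_derive s 1 (p^~ t) a.
  have := is_deriveD (is_deriveD (is_derive_cst x s 1)
    (is_derive_scalel a (is_derive_id s 1))) (is_derive_cst (t *: b) s 1).
  by rewrite add0r scale1r addr0.
have dp2 (s t : K) : is_derive t 1 (p s) b.
  have := is_deriveD (is_derive_cst (x + s *: a) t 1)
    (is_derive_scalel b (is_derive_id t 1)).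
  by rewrite add0r scale1r.
have [Da Ca] := CF a; have [Db Cb] := CF b.
have cp (H : 'rV[K]_m -> K) : continuous H -> continuous_at0 (fun s t => H (p s t)).
  move=> cH e e0; have p0 : p 0 0 = x by rewrite /p !scale0r !addr0.
  have /cvgrPdist_lt/(_ _ e0)/nbhs_ballP [r /= r0 Hr] := cH x.
  (* The summand 1 makes [r / k] meaningful when [a] and [b] both vanish. *)
  pose k := `|a| + `|b| + 1.
  have k0 : 0 < k by rewrite ltr_wpDl ?addr_ge0.
  exists (r / k) => [|s t hs ht]; first by rewrite divr_gt0.
  rewrite p0 distrC; apply: Hr; rewrite -ball_normE /=.
  rewrite /p -addrA opprD addrA subrr sub0r normrN.
  apply: le_lt_trans (ler_normD _ _) _; rewrite !normrZ.
  apply: le_lt_trans (_ : r / k * (`|a| + `|b|) < _).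
    by rewrite mulrDr lerD // ler_wpM2r // ltW.
  rewrite mulrAC ltr_pdivrMr // ltr_pM2l // /k.
  by rewrite ltrDl.
have := @schwarz_plane K (fun s t => F (p s t)) (fun s t => 'D_a F (p s t))
  (fun s t => 'D_b F (p s t)) (fun s t => 'D_b (fun y => 'D_a F y) (p s t))
  (fun s t => 'D_a (fun y => 'D_b F y) (p s t)) KRC.
have p0 : p 0 0 = x by rewrite /p !scale0r !addr0.
rewrite /= p0; apply.
- by move=> s t; exact: (is_derive_curve (c := p^~ t)).
- by move=> s t; exact: (is_derive_curve (c := p s)).
- by move=> s t; exact: (is_derive_curve (F := fun y => 'D_a F y) (c := p s)).
- by move=> s t; exact: (is_derive_curve (F := fun y => 'D_b F y) (c := p^~ t)).
- exact: (cp _ (Ca b)).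
- exact: (cp _ (Cb a)).
Qed.

Variable V : vectType K.
Implicit Types (f g : V -> K) (X u v : V).

Lemma smooth_differentiable f (x : 'rV[K]_(dim V)) :
  f \in @smooth K V -> differentiable (f \o r2v) x.
Proof. by move=> /smoothP/(_ 1%N) []. Qed.

Lemma dirD_linear f X : f \in @smooth K V -> scalar (dirD f X).
Proof.
move=> sf k u v; rewrite /dirD !deriveE; do ?exact: smooth_differentiable.
by rewrite !linearP.
Qed.

Lemma smooth_dirD f v : f \in @smooth K V -> (fun X => dirD f X v) \in @smooth K V.
Proof.
move=> /smoothP sf; apply/smoothP => n; have [_ /(_ (v2r v))] := sf n.+1.
by congr Ck; apply/funext => x; rewrite /dirD /= r2vK.
Qed.

Lemma dirD_sym f X u v : real_or_complex K -> f \in @smooth K V ->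
  dirD (fun Y => dirD f Y u) X v = dirD (fun Y => dirD f Y v) X u.
Proof.
move=> KRC /smoothP sf.
have E w : (fun Y => dirD f Y w) \o r2v = (fun y => 'D_(v2r w) (f \o r2v) y).
  by apply/funext => y; rewrite /dirD /= r2vK.
by rewrite /dirD !E; apply: Ck_derive_sym.
Qed.

Lemma dirD_curve f (c : K -> V) (t : K) v : f \in @smooth K V ->
  is_derive t 1 (fun s => v2r (c s) : 'rV[K]_(dim V)) (v2r v) ->
  is_derive t 1 (fun s => f (c s)) (dirD f (c t) v).
Proof.
move=> sf dc; have := is_derive_curve (smooth_differentiable _ sf) dc.
by congr is_derive; apply/funext => s /=; rewrite v2rK.
Qed.

(** Smoothness and a derivative formula travel together, so each rule below delivers both; in
    [df X v] the direction is [v]. *)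
Definition has_dirD (f : V -> K) (df : V -> V -> K) : Prop :=
  f \in @smooth K V /\ forall X v, dirD f X v = df X v.

Lemma has_dirD_cst (k : K) : has_dirD (fun=> k) (fun _ _ => 0).
Proof.
by split=> [|X v]; [apply/smoothP => n; exact: Ck_cst|exact: derive_cst].
Qed.

Lemma has_dirDD f df g dg : has_dirD f df -> has_dirD g dg ->
  has_dirD (fun X => f X + g X) (fun X v => df X v + dg X v).
Proof.
move=> [sf fE] [sg gE]; split=> [|X v]; first exact: (rpredD sf sg).
rewrite -fE -gE; apply: (@deriveD _ _ _ (f \o r2v) (g \o r2v));
  exact/diff_derivable/smooth_differentiable.
Qed.

Lemma has_dirDM f df g dg : has_dirD f df -> has_dirD g dg ->
  has_dirD (fun X => f X * g X) (fun X v => f X * dg X v + g X * df X v).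
Proof.
move=> [sf fE] [sg gE]; split=> [|X v]; first exact: (rpredM sf sg).
rewrite -fE -gE.
have := @deriveM _ _ (f \o r2v) (g \o r2v) (v2r X) (v2r v).
rewrite /= v2rK; apply; exact/diff_derivable/smooth_differentiable.
Qed.

Lemma has_dirD_eq f df df' : (forall X v, df X v = df' X v) ->
  has_dirD f df -> has_dirD f df'.
Proof. by move=> E [sf fE]; split=> // X v; rewrite fE. Qed.

Lemma has_dirD_sum (I : Type) (r : seq I) (f : I -> V -> K) (df : I -> V -> V -> K) :
  (forall i, has_dirD (f i) (df i)) ->
  has_dirD (fun X => \sum_(i <- r) f i X) (fun X v => \sum_(i <- r) df i X v).
Proof.
move=> H; elim: r => [|i r IH].
  have -> : (fun X => \sum_(i <- [::]) f i X) = (fun=> 0).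
    by apply/funext => X; rewrite big_nil.
  by apply: has_dirD_eq (has_dirD_cst 0) => X v; rewrite big_nil.
have -> : (fun X => \sum_(j <- i :: r) f j X) =
    (fun X => f i X + \sum_(j <- r) f j X).
  by apply/funext => X; rewrite big_cons.
by apply: has_dirD_eq (has_dirDD (H i) IH) => X v; rewrite big_cons.
Qed.

(** A linear form is a combination of coordinates, hence continuous; it is then its own differential
    at every point. *)
Lemma has_dirD_scalar (f : {scalar V}) : has_dirD f (fun _ v => f v).
Proof.
have flin : linear (fun x : 'rV[K]_(dim V) => f (r2v x) : K^o).
  by move=> k x y; rewrite !linearP.
pose fL : {linear 'rV[K]_(dim V) -> K^o} :=
  HB.pack (fun x : 'rV[K]_(dim V) => f (r2v x) : K^o)
    (GRing.isLinear.Build _ _ _ _ _ flin).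
have fc : continuous fL.
  have -> : (fL : 'rV[K]_(dim V) -> K^o) =
      \sum_j (fun x : 'rV[K]_(dim V) => x 0 j *: fL (delta_mx 0 j)).
    apply/funext => x; rewrite fct_sumE {1}[x]row_sum_delta linear_sum.
    by apply: eq_bigr => j _; rewrite linearZ.
  move=> x; apply: differentiable_continuous; apply: differentiable_sum => j.
  by apply: differentiableZl; exact: differentiable_coord.
have D X v : dirD f X v = f v.
  rewrite /dirD deriveE; last exact: (@linear_differentiable _ _ _ fL).
  by rewrite (@diff_lin _ _ _ fL) //= v2rK.
split=> //; apply/smoothP => -[|n]; first exact: fc.
split=> [x|v]; first exact: (@linear_differentiable _ _ _ fL).
have -> : (fun x => 'D_v (f \o r2v) x) = cst (f (r2v v)); last exact: Ck_cst.
by apply/funext => x; have := D (r2v x) (r2v v); rewrite /dirD !r2vK.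
Qed.

End DirectionalDerivative.

(** * Derivatives of maps between finite-dimensional spaces *)

Section VectorValued.
Variables (K : numFieldType) (V : vectType K).

(** The derivative is weak, tested against all linear forms, since the target carries no
    topology. *)
Definition has_vdirD (W : vectType K) (F : V -> W) (dF : V -> V -> W) : Prop :=
  forall phi : {scalar W}, has_dirD (fun X => phi (F X)) (fun X v => phi (dF X v)).

Lemma has_vdirD_linear (W : vectType K) (F : {linear V -> W}) :
  has_vdirD F (fun _ v => F v).
Proof.
move=> phi.
have lin : scalar (fun X => phi (F X)) by move=> k x y; rewrite !linearP.
pose phiF : {scalar V} := HB.pack (fun X => phi (F X))
  (GRing.isLinear.Build _ _ _ _ _ lin).
exact: (has_dirD_scalar phiF).
Qed.

Lemma has_vdirDD (W : vectType K) (F G : V -> W) dF dG :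
  has_vdirD F dF -> has_vdirD G dG ->
  has_vdirD (fun X => F X + G X) (fun X v => dF X v + dG X v).
Proof.
move=> HF HG phi.
have -> : (fun X => phi (F X + G X)) = (fun X => phi (F X) + phi (G X)).
  by apply/funext => X; rewrite linearD.
by apply: has_dirD_eq (has_dirDD (HF phi) (HG phi)) => X v; rewrite linearD.
Qed.

Lemma has_vdirD_comb (W : vectType K) (I : Type) (r : seq I) (f : I -> V -> K) df
    (w : I -> W) :
  (forall i, has_dirD (f i) (df i)) ->
  has_vdirD (fun X => \sum_(i <- r) f i X *: w i)
    (fun X v => \sum_(i <- r) df i X v *: w i).
Proof.
move=> H phi.
have -> : (fun X => phi (\sum_(i <- r) f i X *: w i)) =
    (fun X => \sum_(i <- r) phi (w i) * f i X).
  apply/funext => X; rewrite linear_sum; apply: eq_bigr => i _.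
  by rewrite linearZ /= mulrC.
have H' i := has_dirDM (has_dirD_cst V (phi (w i))) (H i).
apply: has_dirD_eq (has_dirD_sum r H') => X v.
rewrite linear_sum; apply: eq_bigr => i _.
by rewrite linearZ /= mulr0 addr0 mulrC.
Qed.

(** In bases, [phi (mu x y)] is a combination of products of one coordinate of [x] and one of [y],
    so the scalar product rule applies. *)
Lemma has_vdirD_bilinear (W1 W2 W3 : vectType K) (mu : W1 -> W2 -> W3)
    (F : V -> W1) (G : V -> W2) dF dG :
  (forall y, linear (mu^~ y)) -> (forall x, linear (mu x)) ->
  has_vdirD F dF -> has_vdirD G dG ->
  has_vdirD (fun X => mu (F X) (G X))
    (fun X v => mu (dF X v) (G X) + mu (F X) (dG X v)).
Proof.
move=> lin1 lin2 HF HG phi.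
pose e := vbasis {:W1}; pose e' := vbasis {:W2}.
have muE x y : phi (mu x y) = \sum_(i < \dim {:W1}) \sum_(j < \dim {:W2})
    phi (mu e`_i e'`_j) * (coord e i x * coord e' j y).
  pose m1 y := HB.pack_for {linear W1 -> W3} (mu^~ y)
    (GRing.isLinear.Build _ _ _ _ _ (lin1 y)).
  pose m2 x := HB.pack_for {linear W2 -> W3} (mu x)
    (GRing.isLinear.Build _ _ _ _ _ (lin2 x)).
  rewrite {1}(coord_vbasis (memvf x)) -[mu _ y]/(m1 y _) !linear_sum.
  apply: eq_bigr => i _; rewrite !linearZ /=.
  rewrite {1}(coord_vbasis (memvf y)) -[mu _ _]/(m2 _ _) !linear_sum mulr_sumr.
  by apply: eq_bigr => j _; rewrite !linearZ /= mulrA mulrC.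
have -> : (fun X => phi (mu (F X) (G X))) =
   (fun X => \sum_(i < \dim {:W1}) \sum_(j < \dim {:W2})
    phi (mu e`_i e'`_j) * (coord e i (F X) * coord e' j (G X))).
  by apply/funext => X; rewrite muE.
have H (i : 'I_(\dim {:W1})) (j : 'I_(\dim {:W2})) :=
  has_dirDM (has_dirD_cst V (phi (mu e`_i e'`_j)))
  (has_dirDM (HF (coord e i)) (HG (coord e' j))).
have H' i := has_dirD_sum (index_enum _) (H i).
apply: has_dirD_eq (has_dirD_sum (index_enum _) H') => X v /=.
rewrite linearD /= !muE -big_split; apply: eq_bigr => i _.
rewrite -big_split; apply: eq_bigr => j _ /=.
ring.
Qed.

End VectorValued.

(** * Duality between L and B *)

Section PerfectPairing.
Variables (K : fieldType) (V W : vectType K) (p : V -> W -> K).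
Hypothesis linl : forall w, scalar (p^~ w).
Hypothesis linr : forall v, scalar (p v).
Variables (U : {vspace V}) (T : {vspace W}).

Let eU := vbasis U.

(** The map from [W] to the dual of [U] induced by [p], in coordinates. By [nondegr] it is injective
    on [T]. *)
Let coords (w : W) : 'rV[K]_(\dim U) := \row_i p eU`_i w.

Let coords_linear : linear coords.
Proof. by move=> k x y; apply/rowP => i; rewrite !mxE linr. Qed.

Let dim_row n : dim 'rV[K]_n = n.
Proof. exact: etrans (dim_matrix _ _ _) (mul1n n). Qed.

Let f : 'Hom(W, 'rV[K]_(\dim U)) :=
  linfun (HB.pack_for {linear W -> 'rV[K]_(\dim U)} coords
    (GRing.isLinear.Build _ _ _ _ _ coords_linear)).

Let fE w i : f w 0 i = p eU`_i w.
Proof. by rewrite lfunE /= mxE. Qed.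

Let p_coord (phi : V -> K) u : scalar phi -> u \in U ->
  phi u = \sum_(i < \dim U) coord eU i u * phi eU`_i.
Proof.
move=> lin uU; pose phiL := HB.pack_for {scalar V} phi
    (GRing.isLinear.Build _ _ _ _ _ lin).
rewrite {1}(coord_vbasis uU) -[phi _]/(phiL _) linear_sum.
by apply: eq_bigr => i _; rewrite linearZ.
Qed.

Hypothesis nondegr :
  forall w, w \in T -> (forall u, u \in U -> p u w = 0) -> w = 0.

Let dim_limg : \dim (f @: T) = \dim T.
Proof.
apply: limg_dim_eq; apply/vspaceP => w; rewrite memv0 memv_cap memv_ker.
apply/andP/eqP => [[wT /eqP fw]|->]; last by rewrite mem0v linear0 eqxx.
apply: nondegr => // u uU; rewrite (p_coord (linl w)) // big1 // => i _.
by rewrite -fE fw mxE mulr0.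
Qed.

Lemma pairing_dim_le : (\dim T <= \dim U)%N.
Proof.
rewrite -dim_limg; apply: leq_trans (dimvS (subvf _)) _.
by rewrite dimvf dim_row.
Qed.

(** The injection of [T] into the dual of [U] is onto once the dimensions agree. With the roles of
    the two sides exchanged, [pairing_dim_le] supplies the missing inequality. *)
Lemma pairing_represents : (\dim U <= \dim T)%N ->
  forall phi : V -> K, scalar phi ->
  exists2 w, w \in T & forall u, u \in U -> phi u = p u w.
Proof.
move=> le phi lin.
have full : (f @: T)%VS = fullv.
  apply/eqP; rewrite eqEdim subvf dim_limg dimvf dim_row.
  exact: le.
have /memv_imgP [w wT E] : \row_i phi eU`_i \in (f @: T)%VS by rewrite full memvf.
exists w => // u uU; rewrite (p_coord lin) // (p_coord (linl w)) //.
by apply: eq_bigr => i _; rewrite -fE -E mxE.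
Qed.

End PerfectPairing.

Lemma graded_decomposition (K : fieldType) (V : vectType K)
    (G : int -> {vspace V}) (v : V) : is_grading G ->
  exists s : seq int, exists c : int -> V,
    [/\ uniq s, forall i, c i \in G i & v = \sum_(i <- s) c i].
Proof.
move=> [s [us _ _ sf]]; exists s.
have : v \in (\sum_(i <- s) G i)%VS by rewrite sf memvf.
elim: s us {sf} v => [|j s IH] /= us v.
  rewrite big_nil memv0 => /eqP ->; exists (fun=> 0).
  by split=> // [i|]; [exact: mem0v|rewrite big_nil].
case/andP: us => js us; rewrite big_cons => /memv_addP [x xj [y ys ->]].
have [c [_ cG ->]] := IH us y ys.
exists (fun i => if i == j then x else c i); split=> //.
- by rewrite js.
- by move=> i; case: eqP => [->|].
rewrite big_cons eqxx; congr (_ + _); apply: eq_big_seq => i si.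
by case: eqP js => // <-; rewrite si.
Qed.

Lemma linear_zero (K : fieldType) (V W : lmodType K) (f : V -> W) :
  linear f -> f 0 = 0.
Proof. by move=> lin; have := lin (-1) 0 0; rewrite !scaleN1r !addNr. Qed.

(** * Adjoints and representing elements for the pairing of an MCP structure *)

Section MCPPairing.
Variables (K : numFieldType) (L : dgla K) (B : gcalg K) (pair : L -> B -> K).
Hypothesis P : is_pairing pair.
Local Notation Lgr := (@dgla_gr K L).
Local Notation Bgr := (@gca_gr K B).
Local Notation "a /^ b" := (gca_mul a b) (at level 40, left associativity).
Local Notation "[: a , b ]" := (@dgla_br K L a b)
  (at level 0, format "[: a ,  b ]").
Local Notation dX X := (twisted_d (vsval X)).
Local Notation delta := (adj_delta pair).

Let pl b : scalar (pair^~ b). Proof. exact: (pair_linearl P). Qed.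
Let pr a : scalar (pair a). Proof. exact: (pair_linearr P). Qed.

Lemma pair0l b : pair 0 b = 0. Proof. exact: (@linear_zero _ L K^o _ (pl b)). Qed.
Lemma pair0r a : pair a 0 = 0. Proof. exact: (@linear_zero _ B K^o _ (pr a)). Qed.
Lemma pairDl a a' b : pair (a + a') b = pair a b + pair a' b.
Proof. by have := pl b 1 a a'; rewrite scale1r mul1r. Qed.
Lemma pairDr a b b' : pair a (b + b') = pair a b + pair a b'.
Proof. by have := pr a 1 b b'; rewrite scale1r mul1r. Qed.
Lemma pairZl k a b : pair (k *: a) b = k * pair a b.
Proof. by have := pl b k a 0; rewrite pair0l !addr0. Qed.
Lemma pairZr k a b : pair a (k *: b) = k * pair a b.
Proof. by have := pr a k b 0; rewrite pair0r !addr0. Qed.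
Lemma pairNl a b : pair (- a) b = - pair a b.
Proof. by rewrite -scaleN1r pairZl mulN1r. Qed.
Lemma pairNr a b : pair a (- b) = - pair a b.
Proof. by rewrite -scaleN1r pairZr mulN1r. Qed.
Lemma pair_sumr (I : Type) (r : seq I) (F : I -> B) a :
  pair a (\sum_(i <- r) F i) = \sum_(i <- r) pair a (F i).
Proof.
elim: r => [|i r IH]; first by rewrite !big_nil pair0r.
by rewrite !big_cons pairDr IH.
Qed.
Lemma pair_suml (I : Type) (r : seq I) (F : I -> L) b :
  pair (\sum_(i <- r) F i) b = \sum_(i <- r) pair (F i) b.
Proof.
elim: r => [|i r IH]; first by rewrite !big_nil pair0l.
by rewrite !big_cons pairDl IH.
Qed.

Lemma pair_component_l (s : seq int) (c : int -> L) j b :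
  uniq s -> (forall i, c i \in Lgr i) -> b \in Bgr (j + 1) -> j \in s ->
  pair (\sum_(i <- s) c i) b = pair (c j) b.
Proof.
move=> us cL bB js; rewrite pair_suml (bigD1_seq j) //= big1 ?addr0 // => i ij.
by apply: (pair_deg P (cL i) bB); rewrite (inj_eq (addIr _)) eq_sym.
Qed.

Lemma pair_component_r (s : seq int) (c : int -> B) j a :
  uniq s -> (forall i, c i \in Bgr i) -> a \in Lgr (j - 1) -> j \in s ->
  pair a (\sum_(i <- s) c i) = pair a (c j).
Proof.
move=> us cB aL js; rewrite pair_sumr (bigD1_seq j) //= big1 ?addr0 // => i ij.
by apply: (pair_deg P aL (cB i)); rewrite subrK.
Qed.

(** Non-degeneracy is given degree by degree. Pairing with an element of degree [i + 1] isolates the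
    component of degree [i], which carries it over to all of [L]. *)
Lemma pair_eq0l a : (forall b, pair a b = 0) -> a = 0.
Proof.
have [s [c [us cL ->]]] := graded_decomposition a (dgla_grading L) => H.
rewrite big1_seq // => i /= si; apply: (pair_nondegl P (cL i)) => b bB.
by rewrite -(pair_component_l us cL bB si) H.
Qed.

Lemma pair_injr b b' : (forall a, pair a b = pair a b') -> b = b'.
Proof.
move=> H; apply/eqP; rewrite -subr_eq0; apply/eqP.
have {H} : forall a, pair a (b - b') = 0.
  by move=> a; rewrite pairDr pairNr H subrr.
have [s [c [us cB ->]]] := graded_decomposition (b - b') (gca_grading B) => H.
rewrite big1_seq // => j /= sj.
apply: (@pair_nondegr _ _ _ _ P (j - 1)) => [|a aL]; first by rewrite subrK.
by rewrite -(pair_component_r us cB aL sj) H.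
Qed.

(** Components of [b] outside degree [j] pair to zero with everything, hence vanish. This is how
    degrees of adjoints are found. *)
Lemma mem_gr_pair j b :
  (forall i a, a \in Lgr i -> j != i + 1 -> pair a b = 0) -> b \in Bgr j.
Proof.
have [s [c [us cB ->]]] := graded_decomposition b (gca_grading B) => H.
rewrite big_seq; apply: memv_suml => i si.
have [<-|ij] := eqVneq i j; first exact: cB.
suff -> : c i = 0 by exact: mem0v.
apply: (@pair_nondegr _ _ _ _ P (i - 1)) => [|a aL]; first by rewrite subrK.
by rewrite -(pair_component_r us cB aL si) (H _ _ aL) // subrK eq_sym.
Qed.

Lemma representation_r i (phi : L -> K) : scalar phi ->
  exists2 b, b \in Bgr (i + 1) & forall a, a \in Lgr i -> phi a = pair a b.
Proof.
move=> lin; have nr := @pair_nondegr _ _ _ _ P i; have nl := @pair_nondegl _ _ _ _ P i.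
apply: (pairing_represents pl pr nr _ lin).
exact: (@pairing_dim_le _ _ _ (fun b a => pair a b) pr pl _ _ nl).
Qed.

Lemma representation_l i (phi : B -> K) : scalar phi ->
  exists2 a, a \in Lgr i & forall b, b \in Bgr (i + 1) -> phi b = pair a b.
Proof.
move=> lin; have nr := @pair_nondegr _ _ _ _ P i; have nl := @pair_nondegl _ _ _ _ P i.
apply: (@pairing_represents _ _ _ (fun b a => pair a b) pr pl _ _ nl _ _ lin).
exact: (pairing_dim_le pl pr nr).
Qed.

(** The ungraded form is the one needed for [adj_delta], whose defining condition ranges over all of
    [L]. *)
Lemma representation (phi : L -> K) : scalar phi ->
  exists b, forall a, phi a = pair a b.
Proof.
move=> lin.
have nr b : b \in {:B}%VS -> (forall a, a \in {:L}%VS -> pair a b = 0) -> b = 0.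
  by move=> _ H; apply: pair_injr => a; rewrite pair0r H // memvf.
have nl a : a \in {:L}%VS -> (forall b, b \in {:B}%VS -> pair a b = 0) -> a = 0.
  by move=> _ H; apply: pair_eq0l => b; rewrite H // memvf.
have le := @pairing_dim_le _ _ _ (fun b a => pair a b) pr pl _ _ nl.
have [b _ H] := pairing_represents pl pr nr le lin.
by exists b => a; rewrite H // memvf.
Qed.

Lemma twisted_d_linear (x : L) : linear (twisted_d x).
Proof.
move=> k a b; rewrite /twisted_d linearP (dgla_br_linearr (d := L)).
by rewrite scalerDr addrACA.
Qed.

Lemma br0l (a : L) : [: 0, a] = 0.
Proof. exact: (linear_zero (dgla_br_linearl (d := L) a)). Qed.

Lemma twisted_d_deg (X : L1 L) i a : a \in Lgr i -> dX X a \in Lgr (i + 1).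
Proof.
move=> aL; apply: memvD; first exact: dgla_d_deg.
by rewrite addrC; apply: (gl_deg (dgla_lie L)) => //; exact: subvsP.
Qed.

(** By [representation] the set in [xget] is inhabited, so the default 0 is not taken; this holds at
    every [X] in L^1. *)
Lemma adj_deltaE (X : L1 L) a b : pair (dX X a) b = pair a (delta X b).
Proof.
have lin : scalar (fun a => pair (dX X a) b).
  by move=> k u v; rewrite twisted_d_linear pl.
have ex := representation lin.
rewrite /adj_delta; case: xgetP => [c _ /(_ a) //|/(_ _) H].
by case: ex => c cE; case: (H c).
Qed.

Lemma adj_delta_linear (X : L1 L) : linear (delta X).
Proof.
by move=> k u v; apply: pair_injr => a; rewrite pairDr pairZr -!adj_deltaE pr.
Qed.

Lemma adj_delta_deg (X : L1 L) i b : b \in Bgr i -> delta X b \in Bgr (i - 1).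
Proof.
move=> bB; apply: mem_gr_pair => j a aL ij; rewrite -adj_deltaE.
apply: (pair_deg P (twisted_d_deg X aL) bB).
by apply: contra ij => /eqP ->; rewrite addrK.
Qed.

(* The linear part of the affine map X |-> delta_X. *)
Definition ad_dual (X : L1 L) (b : B) : B := delta X b - delta 0 b.

Lemma ad_dualE (X : L1 L) a b : pair a (ad_dual X b) = pair [: vsval X, a] b.
Proof.
rewrite pairDr pairNr -!adj_deltaE /twisted_d !pairDl linear0 br0l pair0l.
by rewrite addr0 addrAC subrr add0r.
Qed.

Lemma adj_delta_affine (X : L1 L) b : delta X b = delta 0 b + ad_dual X b.
Proof. by rewrite /ad_dual addrC subrK. Qed.

Lemma ad_dual_linearr (X : L1 L) : linear (ad_dual X).
Proof.
move=> k u v; apply: pair_injr => a.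
by rewrite [RHS]pairDr pairZr !ad_dualE pr.
Qed.

Lemma ad_dual_linearl b : linear (ad_dual^~ b).
Proof.
move=> k X Y; apply: pair_injr => a.
rewrite [RHS]pairDr pairZr !ad_dualE linearP (dgla_br_linearl (d := L)).
exact: pl.
Qed.

Lemma ad_dual_deg (X : L1 L) i b : b \in Bgr i -> ad_dual X b \in Bgr (i - 1).
Proof. by move=> bB; apply: memvB; exact: adj_delta_deg. Qed.

Lemma rhoP (X : L1 L) a : rho pair X a \in Lgr 0 /\
  forall b, b \in Bgr 1 -> pair (vsval X) (a /^ b) = pair (rho pair X a) b.
Proof.
have lin : scalar (fun b => pair (vsval X) (a /^ b)).
  by move=> k u v; rewrite (gca_linearr (g := B)) pr.
have [l lL lE] := representation_l 0 lin.
rewrite /rho; case: xgetP => [c _ //|/(_ l) []].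
by split=> // b bB; exact: lE.
Qed.

Lemma DpairP (f : L1 L -> K) X : f \in @smooth K (L1 L) ->
  Dpair pair f X \in Bgr 2 /\
  forall v : L1 L, dirD f X v = pair (vsval v) (Dpair pair f X).
Proof.
move=> sf.
(* The differential lives on L^1; [vsproj] extends it to a linear form on [L], where the pairing is
   defined. *)
have lin : scalar (fun l => dirD f X (vsproj (Lgr 1) l)).
  by move=> k u v; rewrite linearP dirD_linear.
have [b bB bE] := representation_r 1 lin.
rewrite /Dpair; case: xgetP => [c _ //|/(_ b) []].
split=> // v; have := bE _ (subvsP v); rewrite vsvalK; exact.
Qed.

End MCPPairing.

(** * Tangency of the gauge directions *)

(** The gauge field is affine with linear part [[., l]], so [affine_flow] integrates it. Running the
    curve at speed [s] gives the flow of [s *: l], so each point [g s] is reached from [X] in time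
    one. *)
Lemma gauge_flow_exists (K : numFieldType) (L : dgla K) (X : L1 L) (l : L) :
  real_or_complex K -> l \in dgla_gr L 0 ->
  exists2 g : K -> L1 L, g 0 = X &
    is_derive (0 : K) 1 (fun s => v2r (g s) : 'rV[K]_(dim (L1 L)))
      (v2r (vsproj (dgla_gr L 1) (twisted_d (vsval X) l))) /\
    forall s, gauge_flow (s *: l) X (g s).
Proof.
move=> KRC l0.
have brD a b c : dgla_br (d := L) (a + b) c = dgla_br a c + dgla_br b c.
  by have := dgla_br_linearl (d := L) c 1 a b; rewrite !scale1r.
have Alin : linear (fun v : L1 L => vsproj (dgla_gr L 1) (dgla_br (vsval v) l)).
  by move=> k u v; rewrite linearP (dgla_br_linearl (d := L)) linearP.
pose A := HB.pack_for {linear L1 L -> L1 L}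
  (fun v : L1 L => vsproj (dgla_gr L 1) (dgla_br (vsval v) l))
  (GRing.isLinear.Build _ _ _ _ _ Alin).
pose v := vsproj (dgla_gr L 1) (twisted_d (vsval X) l).
have [g g0 dg] := affine_flow KRC A X v.
(* The projections [vsproj] act as the identity here, since bracketing with [l] of degree 0
   preserves L^1. *)
have vE t : vsval (v + A (g t - X)) = twisted_d (vsval (g t)) l.
  have d1 (Y : L1 L) : twisted_d (vsval Y) l \in dgla_gr L 1.
    by have := twisted_d_deg Y l0; rewrite add0r.
  have b1 (Y : L1 L) : dgla_br (vsval Y) l \in dgla_gr L 1.
    by have := gl_deg (dgla_lie L) (subvsP Y) l0; rewrite addr0.
  rewrite -[LHS]/(vsval (vsproj (dgla_gr L 1) (twisted_d (vsval X) l)) +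
    vsval (vsproj (dgla_gr L 1) (dgla_br (vsval (g t - X)) l))).
  rewrite (vsprojK (d1 X)) (vsprojK (b1 (g t - X))).
  by rewrite /twisted_d -addrA -brD linearB (addrC (vsval X)) subrK.
exists g => //; split.
  have := dg _ (v2r : {linear L1 L -> 'rV[K]_(dim (L1 L))}) 0.
  by rewrite g0 subrr linear0 addr0.
move=> s; exists (fun t => g (s * t)); split; rewrite ?mulr0 ?mulr1 // => t.
have lin : linear (fun x : L1 L => v2r (vsval x) : 'rV[K]_(dim L)).
  by move=> k x y; rewrite !linearP.
pose f := HB.pack_for {linear L1 L -> 'rV[K]_(dim L)}
  (fun x : L1 L => v2r (vsval x) : 'rV[K]_(dim L))
  (GRing.isLinear.Build _ _ _ _ _ lin).
have dfg := dg _ f (s * t).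
have dffg : differentiable (fun u : K => f (g u)) (s * t).
  by apply/derivable1_diffP; case: dfg.
have ds : is_derive t 1 (fun u => s * u) s.
  have := is_deriveZ (f := id) s (is_derive_id t 1).
  by rewrite -[s *: 1]/(s * 1) mulr1.
have := is_derive_curve (c := fun u => s * u) dffg ds.
congr is_derive.
have -> : 'D_s (fun u : K => f (g u)) (s * t) =
    s *: 'D_1 (fun u : K => f (g u)) (s * t).
  by rewrite !deriveE // -linearZ; congr ('d _ _ _); rewrite -[RHS]/(s * 1) mulr1.
case: dfg => _ ->; rewrite -linearZ.
rewrite -[LHS]/(v2r (s *: vsval (v + A (g (s * t) - X)))) vE; congr v2r.
rewrite /twisted_d scalerDr linearZ /=; congr (_ + _).
have := dgla_br_linearr (d := L) (vsval (g (s * t))) s l 0.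
by rewrite addr0 (linear_zero (dgla_br_linearr (d := L) _)) addr0.
Qed.

(** The curve of [gauge_flow_exists] stays in [O], so [f] is constantly 0 along it; its derivative
    at time 0 is the claim. *)
Lemma gauge_tangent (K : numFieldType) (L : dgla K) (O : set (L1 L)) (X : L1 L)
    (l : L) (f : L1 L -> K) :
  real_or_complex K -> union_of_gauge_orbits O -> O X -> l \in dgla_gr L 0 ->
  f \in @smooth K (L1 L) -> (forall Y, O Y -> f Y = 0) ->
  dirD f X (vsproj (dgla_gr L 1) (twisted_d (vsval X) l)) = 0.
Proof.
move=> KRC [S OE] OX l0 sf f0; have [g g0 [dg flow]] := gauge_flow_exists X KRC l0.
have fg s : f (g s) = 0.
  apply: f0; move: OX; rewrite OE => -[Y SY YX]; exists Y => //.
  apply: gauge_orbit_step YX _ (flow s).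
  exact: memvZ.
have := dirD_curve sf dg; rewrite g0 => -[_ <-].
by under eq_fun do rewrite fg; exact: derive_cst.
Qed.

(** * The bracket on smooth functions *)

Section MCPBracket.
Variables (K : numFieldType) (L : dgla K) (B : gcalg K) (pair : L -> B -> K).
Hypothesis KRC : real_or_complex K.
Hypothesis mcp : is_MCP pair.
Local Notation Lgr := (@dgla_gr K L).
Local Notation Bgr := (@gca_gr K B).
Local Notation "a /^ b" := (gca_mul a b) (at level 40, left associativity).
Local Notation "[: a , b ]" := (@dgla_br K L a b)
  (at level 0, format "[: a ,  b ]").
Local Notation delta := (adj_delta pair).
Local Notation rho := (rho pair).

Let P : is_pairing pair := mcp_pairing mcp.

Let mul1C a b : a \in Bgr 1 -> b \in Bgr 1 -> a /^ b = - (b /^ a).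
Proof. by move=> aB bB; rewrite (gca_mulC aB bB) mulr1 expr1z scaleN1r. Qed.

Let deltaB1 (X : L1 L) b : b \in Bgr 2 -> delta X b \in Bgr 1.
Proof. by move=> bB; exact: (adj_delta_deg P X bB). Qed.

Let adB1 (X : L1 L) b : b \in Bgr 2 -> ad_dual pair X b \in Bgr 1.
Proof. by move=> bB; exact: (ad_dual_deg P X bB). Qed.

Let mulB2 a b : a \in Bgr 1 -> b \in Bgr 1 -> a /^ b \in Bgr 2.
Proof. by move=> aB bB; exact: (gca_deg aB bB). Qed.

Definition ham (X : L1 L) (b : B) : L := twisted_d (vsval X) (rho X (delta X b)).

Lemma ham_deg (X : L1 L) b : ham X b \in Lgr 1.
Proof. exact: (twisted_d_deg X (proj1 (rhoP P X (delta X b)))). Qed.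

Lemma pair_ham (X : L1 L) b c : c \in Bgr 2 ->
  pair (ham X b) c = pair (vsval X) (delta X b /^ delta X c).
Proof.
move=> cB; rewrite /ham (adj_deltaE P).
by rewrite (proj2 (rhoP P X (delta X b))) // deltaB1.
Qed.

(** [d_X] is a derivation of the bracket for every [X] in L^1: Leibniz for [d], Jacobi for the
    bracket with [X]. The minus sign comes from antisymmetry in degrees 0 and 1. *)
Lemma twisted_d_br0 (X : L1 L) u v : u \in Lgr 0 -> v \in Lgr 0 ->
  twisted_d (vsval X) [: u, v] =
  [: twisted_d (vsval X) u, v] - [: twisted_d (vsval X) v, u].
Proof.
move=> u0 v0; have X1 := subvsP X.
have anti w : w \in Lgr 1 -> [: u, w] = - [: w, u].
  by move=> w1; rewrite (gl_antisym (dgla_lie L) u0 w1) mul0r expr0z scale1r.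
have Xv : [: vsval X, v] \in Lgr 1.
  by have := gl_deg (dgla_lie L) X1 v0; rewrite addr0.
have dv : dgla_d L v \in Lgr 1 by have := dgla_d_deg v0; rewrite add0r.
have brD a b c : [: a + b, c] = [: a, c] + [: b, c].
  by have := dgla_br_linearl (d := L) c 1 a b; rewrite !scale1r.
rewrite /twisted_d (dgla_leibniz _ u0) expr0z scale1r.
have -> : [: vsval X, [: u, v]] = [: [: vsval X, u], v] + [: u, [: vsval X, v]].
  by have := gl_jacobi (dgla_lie L) X1 u0 v0; rewrite mulr0 expr0z scale1r.
by rewrite (anti _ Xv) (anti _ dv) !brD opprD addrACA.
Qed.

(** * Consequences of the BV identities at a Maurer-Cartan element *)

Section AtMC.
Variable X : L1 L.
Hypothesis XMC : MC X.

Let delta_delta b : delta X (delta X b) = 0.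
Proof. exact: (bv_square (mcp_BV mcp XMC)). Qed.

Let triple a b c := pair (vsval X) (a /^ delta X (b /^ c)).

Let triple_cyclic a b c : a \in Bgr 1 -> b \in Bgr 1 -> c \in Bgr 1 ->
  delta X a = 0 -> delta X b = 0 -> delta X c = 0 ->
  triple a b c + triple b c a + triple c a b = 0.
Proof.
move=> aB bB cB da db dc.
have mul0B (x : B) : (0 : B) /^ x = 0 by exact: (linear_zero (gca_linearl (g := B) x)).
have mulB0 (x : B) : x /^ (0 : B) = 0 by exact: (linear_zero (gca_linearr (g := B) x)).
have mulBN (x y : B) : x /^ (- y) = - (x /^ y).
  by have := gca_linearr (g := B) x (-1) y 0; rewrite mulB0 !addr0 !scaleN1r.
have dN (x : B) : delta X (- x) = - delta X x.
  have := adj_delta_linear P X (-1) x 0.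
  by rewrite (linear_zero (adj_delta_linear P X)) !addr0 !scaleN1r.
have := bv_order2 (mcp_BV mcp XMC) aB bB cB.
rewrite da db dc !mul0B !mulB0 !mul0B !scaler0 !addr0 expr1z !scaleN1r opprK.
rewrite mulr1 -[1 + 1]/(2 : int) -[(-1) ^ 2]/((-1) ^+ 2) sqrrN expr1n scale1r.
move=> /(congr1 (pair (vsval X))); rewrite (pair0r P) !(pairDr P) !(pairNr P).
(* The leading term is [(d_X X, a /^ b /^ c)], which vanishes. Anticommuting factors of degree 1
   then puts the three remaining terms in cyclic form. *)
rewrite -(adj_deltaE P) (mcp_dX mcp XMC) (pair0l P) add0r.
rewrite (mul1C _ cB); last by apply: deltaB1; exact: mulB2.
rewrite (mul1C aB cB) dN mulBN !(pairNr P) !opprK => H.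
rewrite -[RHS]H /triple; ring.
Qed.

(** [T] is the part of the double bracket without second derivatives: its first term comes from
    varying [X] in the pairing, the other two from varying [delta X]. *)
Lemma jacobi_linear (al be ga : B) :
  al \in Bgr 2 -> be \in Bgr 2 -> ga \in Bgr 2 ->
  let T x y z := pair (ham X x) (delta X y /^ delta X z)
    - pair [: ham X x, rho X (delta X z)] y
    + pair [: ham X x, rho X (delta X y)] z in
  T al be ga + T be ga al + T ga al be = 0.
Proof.
move=> alB beB gaB /=.
have B1 x : x \in Bgr 2 -> delta X x \in Bgr 1 by exact: deltaB1.
have lead x y z : x \in Bgr 2 -> y \in Bgr 2 -> z \in Bgr 2 ->
    pair (ham X x) (delta X y /^ delta X z) =
    triple (delta X x) (delta X y) (delta X z).
  move=> xB yB zB; rewrite /ham (adj_deltaE P) /triple.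
  rewrite (proj2 (rhoP P X (delta X x))) // deltaB1 // mulB2 // B1 //.
pose q x y z := pair [: ham X x, rho X (delta X y)] z.
have [k Hk] := mcp_rho mcp XMC.
(* The difference is [(d_X [rho a, rho b], z)] with [a], [b] the images of [x], [y]. Adjunction and
   the MCP condition on [rho] turn it into [k] times a pairing with the BV bracket, which is
   [- delta X (a /^ b)] as [a] and [b] are closed. *)
have tail x y z : x \in Bgr 2 -> y \in Bgr 2 -> z \in Bgr 2 ->
    q x y z - q y x z =
    k * triple (delta X z) (delta X x) (delta X y).
  move=> xB yB zB.
  have [rx _] := rhoP P X (delta X x); have [ry _] := rhoP P X (delta X y).
  rewrite /q -(pairNl P) -(pairDl P) -(twisted_d_br0 X rx ry) (adj_deltaE P).
  rewrite (Hk _ _ (B1 _ xB) (B1 _ yB)) (pairZl P); congr (_ * _).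
  rewrite -(proj2 (rhoP P X _)) ?B1 // /bv_bracket !delta_delta expr1z !scaleN1r.
  rewrite (linear_zero (gca_linearl (g := B) (delta X y))).
  rewrite (linear_zero (gca_linearr (g := B) (delta X x))).
  rewrite !(subr0, oppr0).
  set w := delta X (_ /^ _); have wB : w \in Bgr 1 by rewrite deltaB1 // mulB2 // B1.
  rewrite (mul1C _ (B1 _ zB)) ?rpredN //.
  have := gca_linearr (g := B) (delta X z) (-1) w 0.
  rewrite (linear_zero (gca_linearr (g := B) (delta X z))) !addr0 !scaleN1r => ->.
  by rewrite opprK.
have tc := triple_cyclic (B1 _ alB) (B1 _ beB) (B1 _ gaB)
  (delta_delta _) (delta_delta _) (delta_delta _).
have e1 := tail _ _ _ alB beB gaB; have e2 := tail _ _ _ beB gaB alB.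
have e3 := tail _ _ _ gaB alB beB.
rewrite !lead // -!/(q _ _ _).
move: (triple _ _ _) (triple _ _ _) (triple _ _ _) tc e1 e2 e3 => t1 t2 t3 tc e1 e2 e3.
(* The [q] terms are regrouped by their last argument to match [tail]; the total is [1 + k] times
   the vanishing cyclic sum. *)
transitivity ((t1 + t2 + t3) + ((q al be ga - q be al ga) +
  (q be ga al - q ga be al) + (q ga al be - q al ga be))); first by ring.
rewrite e1 e2 e3; transitivity ((1 + k) * (t3 + t2 + t1)); first by ring.
by rewrite tc mulr0.
Qed.

End AtMC.

(** [H X v] is the Hessian of [f] at [X] contracted with [v], as an element of B^2. Its symmetry is
    Schwarz's theorem. *)
Lemma has_vdirD_Dpair (f : L1 L -> K) : f \in @smooth K (L1 L) ->
  exists2 H : L1 L -> L1 L -> B, has_vdirD (Dpair pair f) H &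
    (forall X v, H X v \in Bgr 2) /\
    forall X v w : L1 L, pair (vsval w) (H X v) = pair (vsval v) (H X w).
Proof.
move=> sf; pose e := vbasis {:L1 L}.
have rep (i : 'I_(\dim {:L1 L})) : exists2 b, b \in Bgr 2 &
    forall v : L1 L, coord e i v = pair (vsval v) b.
  have lin : scalar (fun l => coord e i (vsproj (Lgr 1) l)).
    by move=> k u v; rewrite !linearP.
  have [b bB bE] := representation_r P 1 lin; exists b => // v.
  by rewrite -(bE _ (subvsP v)) vsvalK.
(* The [be i] represent the coordinate forms of L^1, so the partial derivatives of [f] are the
   coefficients of [Dpair] on them. *)
pose be i := s2val (cid2 (rep i)).
have beB i : be i \in Bgr 2 by rewrite /be; case: cid2.
have beE i v : coord e i v = pair (vsval v) (be i) by rewrite /be; case: cid2.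
have DE X : Dpair pair f X = \sum_(i < \dim {:L1 L}) dirD f X e`_i *: be i.
  have [D2 DE] := DpairP P X sf; apply/eqP; rewrite -subr_eq0; apply/eqP.
  apply: (@pair_nondegr _ _ _ _ P 1).
    by apply: memvB => //; apply: memv_suml => i _; exact: memvZ.
  move=> a aL; rewrite (pairDr P) (pairNr P) (pair_sumr P).
  have -> : a = vsval (vsproj (Lgr 1) a) by rewrite vsprojK.
  set v := vsproj _ a; rewrite -DE.
  have lin := dirD_linear X sf.
  pose phi := HB.pack_for {scalar L1 L} (dirD f X)
    (GRing.isLinear.Build _ _ _ _ _ lin).
  rewrite {1}(coord_vbasis (memvf v)) -[dirD f X _]/(phi _) linear_sum.
  apply/eqP; rewrite subr_eq0; apply/eqP; apply: eq_bigr => i _.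
  by rewrite linearZ /= (pairZr P) -beE mulrC.
pose H X v := \sum_(i < \dim {:L1 L}) dirD (fun Y => dirD f Y e`_i) X v *: be i.
have HE X v w : pair (vsval w) (H X v) = dirD (fun Y => dirD f Y w) X v.
  have Dw (u : L1 L) : has_dirD (fun Y => dirD f Y u)
      (fun X v => dirD (fun Y => dirD f Y u) X v).
    by split=> //; exact: smooth_dirD.
  have -> : (fun Y => dirD f Y w) =
      (fun Y => \sum_(i < \dim {:L1 L}) coord e i w * dirD f Y e`_i).
    apply/funext => Y; have lin := dirD_linear Y sf.
    pose phi := HB.pack_for {scalar L1 L} (dirD f Y)
      (GRing.isLinear.Build _ _ _ _ _ lin).
    rewrite {1}(coord_vbasis (memvf w)) -[dirD f Y _]/(phi _) linear_sum.
    by apply: eq_bigr => i _; rewrite linearZ.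
  have H' (i : 'I_(\dim {:L1 L})) :=
    has_dirDM (has_dirD_cst (L1 L) (coord e i w)) (Dw e`_i).
  have [_ ->] := has_dirD_sum (index_enum _) H'.
  rewrite /H (pair_sumr P); apply: eq_bigr => i _.
  by rewrite (pairZr P) -beE mulr0 addr0 mulrC.
exists H.
  have -> : Dpair pair f = (fun X => \sum_(i < \dim {:L1 L}) dirD f X e`_i *: be i).
    by apply/funext.
  by apply: has_vdirD_comb => i; split=> //; exact: smooth_dirD.
split=> [X v|X v w].
  by apply: memv_suml => i _; exact: memvZ.
by rewrite !HE dirD_sym.
Qed.

(** [delta X] is affine in [X] with linear part [ad_dual]; the second term of the derivative comes
    from that dependence. *)
Lemma has_vdirD_delta (F : L1 L -> B) dF : has_vdirD F dF ->
  has_vdirD (fun X => delta X (F X))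
    (fun X v => delta X (dF X v) + ad_dual pair v (F X)).
Proof.
move=> HF.
pose d0 := HB.pack_for {linear B -> B} (delta 0)
  (GRing.isLinear.Build _ _ _ _ _ (adj_delta_linear P 0)).
have id_lin : has_vdirD (fun X : L1 L => X) (fun _ v => v).
  exact: (has_vdirD_linear (idfun : {linear L1 L -> L1 L})).
have H1 : has_vdirD (fun X => delta 0 (F X)) (fun X v => delta 0 (dF X v)).
  move=> phi; have lin : scalar (fun b => phi (delta 0 b)).
    by move=> k u v; rewrite (adj_delta_linear P) linearP.
  exact: (HF (HB.pack_for {scalar B} (fun b => phi (delta 0 b))
    (GRing.isLinear.Build _ _ _ _ _ lin))).
have H2 := has_vdirD_bilinear (ad_dual_linearl P) (ad_dual_linearr P) id_lin HF.
have -> : (fun X => delta X (F X)) =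
    (fun X => delta 0 (F X) + ad_dual pair X (F X)).
  by apply/funext => X; exact: adj_delta_affine.
move=> phi; apply: has_dirD_eq (has_vdirDD H1 H2 phi) => X v.
by rewrite (adj_delta_affine pair X (dF X v)) addrA addrAC.
Qed.

Lemma has_dirD_mcp_bracket (f g : L1 L -> K) Hf Hg :
  has_vdirD (Dpair pair f) Hf -> has_vdirD (Dpair pair g) Hg ->
  has_dirD (mcp_bracket pair f g) (fun X v =>
    pair (vsval v) (delta X (Dpair pair f X) /^ delta X (Dpair pair g X)) +
    pair (vsval X)
      ((delta X (Hf X v) + ad_dual pair v (Dpair pair f X)) /^
         delta X (Dpair pair g X) +
       delta X (Dpair pair f X) /^
         (delta X (Hg X v) + ad_dual pair v (Dpair pair g X)))).
Proof.
move=> /has_vdirD_delta Df /has_vdirD_delta Dg.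
have M := has_vdirD_bilinear (gca_linearl (g := B)) (gca_linearr (g := B)) Df Dg.
have id_lin := has_vdirD_linear (vsval : {linear L1 L -> L}).
exact: (@has_vdirD_bilinear K (L1 L) L B K^o pair _ _ _ _
  (pair_linearl P) (pair_linearr P) id_lin M (idfun : {scalar K^o})).
Qed.

Lemma smooth_mcp_bracket f g :
  f \in @smooth K (L1 L) -> g \in @smooth K (L1 L) ->
  mcp_bracket pair f g \in @smooth K (L1 L).
Proof.
move=> /has_vdirD_Dpair [Hf Df _] /has_vdirD_Dpair [Hg Dg _].
by have [] := has_dirD_mcp_bracket Df Dg.
Qed.

(** In this form, valid on all of L^1, the bracket is visibly a derivation in [g]; linearity, the
    Leibniz rule and tangency to orbits all start from it. *)
Lemma mcp_bracketE f g X :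
  f \in @smooth K (L1 L) -> g \in @smooth K (L1 L) ->
  mcp_bracket pair f g X =
  dirD g X (vsproj (Lgr 1) (ham X (Dpair pair f X))).
Proof.
move=> sf sg; have [D2 DE] := DpairP P X sg.
by rewrite DE vsprojK ?ham_deg // pair_ham.
Qed.

Lemma mcp_bracket_antisym f g X :
  f \in @smooth K (L1 L) -> g \in @smooth K (L1 L) ->
  mcp_bracket pair f g X = - mcp_bracket pair g f X.
Proof.
move=> sf sg; have [Df _] := DpairP P X sf; have [Dg _] := DpairP P X sg.
rewrite /mcp_bracket -(pairNr P); congr pair.
exact: mul1C (deltaB1 X Df) (deltaB1 X Dg).
Qed.

(** [rho] frees the second factor; its two summands are then moved to the left side by the
    adjunctions for [d_X] and for the bracket with [V]. *)
Lemma pair_mul_derivative (X V : L1 L) z m y :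
  m \in Bgr 2 -> y \in Bgr 2 ->
  pair (vsval X) (delta X z /^ (delta X m + ad_dual pair V y)) =
  pair (ham X z) m + pair [: vsval V, rho X (delta X z)] y.
Proof.
move=> mB yB; have mem : delta X m + ad_dual pair V y \in Bgr 1.
  by apply: memvD; [exact: deltaB1|exact: adB1].
rewrite (proj2 (rhoP P X (delta X z)) _ mem).
rewrite (pairDr P (rho X (delta X z)) (delta X m)); congr (_ + _).
  by rewrite -(adj_deltaE P X (rho X (delta X z)) m).
exact: (ad_dualE P).
Qed.

Lemma mcp_bracket_jacobi f g h X : MC X ->
  f \in @smooth K (L1 L) -> g \in @smooth K (L1 L) -> h \in @smooth K (L1 L) ->
  let br := mcp_bracket pair in
  br f (br g h) X + br g (br h f) X + br h (br f g) X = 0.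
Proof.
move=> XMC sf sg sh /=.
have [Hf Df [Hf2 Hfs]] := has_vdirD_Dpair sf.
have [Hg Dg [Hg2 Hgs]] := has_vdirD_Dpair sg.
have [Hh Dh [Hh2 Hhs]] := has_vdirD_Dpair sh.
have [f2 _] := DpairP P X sf; have [g2 _] := DpairP P X sg.
have [h2 _] := DpairP P X sh.
have [V [VE brE]] : exists V : B -> L1 L,
    (forall b, vsval (V b) = ham X b) /\
    forall u v, u \in @smooth K (L1 L) -> v \in @smooth K (L1 L) ->
      mcp_bracket pair u v X = dirD v X (V (Dpair pair u X)).
  exists (fun b => vsproj (Lgr 1) (ham X b)); split=> [b|u v su sv].
    by rewrite vsprojK // ham_deg.
  exact: mcp_bracketE.
pose T x y z := pair (ham X x) (delta X y /^ delta X z)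
    - pair [: ham X x, rho X (delta X z)] y
    + pair [: ham X x, rho X (delta X y)] z.
(* The double bracket splits into the first-order part [T] and one Hessian term for each inner
   function. *)
have key u v w Hv Hw : u \in @smooth K (L1 L) -> v \in @smooth K (L1 L) ->
    w \in @smooth K (L1 L) -> has_vdirD (Dpair pair v) Hv ->
    has_vdirD (Dpair pair w) Hw -> (forall X v, Hv X v \in Bgr 2) ->
    (forall X v, Hw X v \in Bgr 2) ->
    mcp_bracket pair u (mcp_bracket pair v w) X =
    T (Dpair pair u X) (Dpair pair v X) (Dpair pair w X)
    - pair (vsval (V (Dpair pair w X))) (Hv X (V (Dpair pair u X)))
    + pair (vsval (V (Dpair pair v X))) (Hw X (V (Dpair pair u X))).
  move=> su sv sw Dv Dw Hv2 Hw2.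
  have [v2 _] := DpairP P X sv; have [w2 _] := DpairP P X sw.
  have [_ E] := has_dirD_mcp_bracket Dv Dw.
  rewrite (brE _ _ su (smooth_mcp_bracket sv sw)) {}E.
  have Hv2' := Hv2 X (V (Dpair pair u X)); have Hw2' := Hw2 X (V (Dpair pair u X)).
  have Vu := VE (Dpair pair u X).
  move: (Hv X _) (Hw X _) Hv2' Hw2' => mv mw mv2 mw2.
  move: (V (Dpair pair u X)) Vu => Vu VuE.
  rewrite !VE.
  move: (Dpair pair u X) (Dpair pair v X) (Dpair pair w X) VuE v2 w2 => x y z VuE y2 z2.
  (* Here the varied factor is on the left, so the two factors of degree 1 are exchanged first, at
     the cost of a sign. *)
  have E1 : pair (vsval X) ((delta X mv + ad_dual pair Vu y) /^ delta X z) =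
      - (pair (ham X z) mv + pair [: vsval Vu, rho X (delta X z)] y).
    rewrite (mul1C (memvD (deltaB1 X mv2) (adB1 _ y2)) (deltaB1 X z2)).
    exact: etrans (pairNr P _ _) (congr1 -%R (pair_mul_derivative X Vu z mv2 y2)).
  have E2 := pair_mul_derivative X Vu y mw2 z2.
  apply: etrans (congr2 +%R (erefl _) (pairDr P _ _ _)) _.
  apply: etrans (congr2 +%R (erefl _) (congr2 +%R E1 E2)) _.
  rewrite /T VuE; ring.
rewrite (key f g h Hg Hh) // (key g h f Hh Hf) // (key h f g Hf Hg) //.
move: (Hfs X) (Hgs X) (Hhs X) f2 g2 h2.
move: (Hf X) (Hg X) (Hh X) (Dpair pair f X) (Dpair pair g X) (Dpair pair h X).
move=> mf mg mh x y z mfS mgS mhS x2 y2 z2.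
have J : T x y z + T y z x + T z x y = 0 by exact: jacobi_linear.
(* Each Hessian occurs twice with opposite signs and exchanged arguments; symmetry cancels the pairs
   and leaves the cyclic sum of [T]. *)
rewrite (mfS (V y) (V z)) (mgS (V z) (V x)) (mhS (V x) (V y)) -[RHS]J.
ring.
Qed.

End MCPBracket.

(** * The Poisson structure on the quotient *)

Section PoissonQuotient.
Variables (K : numFieldType) (L : dgla K) (B : gcalg K) (pair : L -> B -> K).
Hypothesis KRC : real_or_complex K.
Hypothesis mcp : is_MCP pair.
Variable O : set (L1 L).
Hypothesis O_MC : O `<=` @MC K L.
Hypothesis O_orbits : union_of_gauge_orbits O.

Local Notation C := (Cinfty (L1 L)).
Local Notation Q := (functions_on O).
Local Notation "{: f }" := (\pi_Q f) (at level 0, format "{: f }").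

Lemma Cinfty_smooth (f : C) : (f : L1 L -> K) \in @smooth K (L1 L).
Proof. by case: f. Qed.
Local Hint Resolve Cinfty_smooth : core.

Definition bracketC (f g : C) : C :=
  MkCinfty (smooth_mcp_bracket KRC mcp (Cinfty_smooth f) (Cinfty_smooth g)).

Lemma bracketCE f g X :
  bracketC f g X = dirD g X (vsproj (dgla_gr L 1) (ham pair X (Dpair pair f X))).
Proof. exact: mcp_bracketE. Qed.

Lemma dirD_Cinfty_linear k (f g : C) X v :
  dirD (k *: f + g : C) X v = k * dirD f X v + dirD g X v.
Proof.
have D (u : C) : has_dirD u (fun X v => dirD u X v) by split.
have [_ E] := has_dirDD (has_dirDM (has_dirD_cst (L1 L) k) (D f)) (D g).
by rewrite -[LHS]/(dirD (fun X => k * f X + g X) X v) E mulr0 addr0.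
Qed.

Lemma dirD_CinftyM (f g : C) X v :
  dirD (f * g : C) X v = f X * dirD g X v + g X * dirD f X v.
Proof.
have D (u : C) : has_dirD u (fun X v => dirD u X v) by split.
by have [_ E] := has_dirDM (D f) (D g); exact: E.
Qed.

Lemma bracketC_antisym f g X : bracketC f g X = - bracketC g f X.
Proof. exact: mcp_bracket_antisym. Qed.

Lemma bracketC_wdr (f g g' : C) X : (forall Y, O Y -> g Y = g' Y) -> O X ->
  bracketC f g X = bracketC f g' X.
Proof.
move=> gg' OX; apply/eqP; rewrite -subr_eq0 !bracketCE; apply/eqP.
have rho0 := proj1 (rhoP (mcp_pairing mcp) X (adj_delta pair X (Dpair pair f X))).
have E Y : O Y -> ((-1) *: g' + g : C) Y = 0.
  move=> OY; rewrite -[LHS]/(-1 * g' Y + g Y) mulN1r gg' // addrC subrr //.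
have := gauge_tangent KRC O_orbits OX rho0 (Cinfty_smooth _) E.
by rewrite dirD_Cinfty_linear mulN1r addrC.
Qed.

(** The arguments are replaced one at a time, with antisymmetry moving the first into the second
    slot. *)
Lemma bracketC_wd (f f' g g' : C) X : (forall Y, O Y -> f Y = f' Y) ->
  (forall Y, O Y -> g Y = g' Y) -> O X -> bracketC f g X = bracketC f' g' X.
Proof.
move=> ff' gg' OX; rewrite (bracketC_wdr f gg' OX) bracketC_antisym.
by rewrite (bracketC_wdr g' ff' OX) -bracketC_antisym.
Qed.

Definition bracketQ (u v : Q) : Q := {: bracketC (repr u) (repr v)}.

Lemma bracketQE f g : bracketQ {: f} {: g} = {: bracketC f g}.
Proof.
apply/functions_onP => X OX.
by apply: bracketC_wd OX; apply/functions_onP; rewrite reprK.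
Qed.

Lemma functions_on_ind (T : Q -> Prop) : (forall f, T {: f}) -> forall u, T u.
Proof. by move=> H u; rewrite -[u]reprK. Qed.

Lemma functions_on_piD (f g : C) : {: f + g} = {: f} + {: g}.
Proof. by rewrite !piE. Qed.

Lemma functions_on_piMr (f g : C) : {: f * g} = {: f} * {: g}.
Proof. exact: functions_on_piM. Qed.

Lemma functions_on_piZr k (f : C) : {: k *: f} = k *: {: f}.
Proof. exact: functions_on_piZ. Qed.

Lemma functions_on_pi0 : {: 0} = 0 :> Q.
Proof. by rewrite !piE. Qed.

Lemma bracketQ_linearr u : linear (bracketQ u).
Proof.
move=> k; elim/functions_on_ind: u => f; elim/functions_on_ind => g.
elim/functions_on_ind => h.
rewrite -functions_on_piZr -functions_on_piD !bracketQE.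
rewrite -functions_on_piZr -functions_on_piD; apply/functions_onP => X OX.
rewrite -[RHS]/(k * bracketC f g X + bracketC f h X) !bracketCE.
exact: dirD_Cinfty_linear.
Qed.

Lemma bracketQ_antisym u v : bracketQ u v = - bracketQ v u.
Proof.
elim/functions_on_ind: u => f; elim/functions_on_ind: v => g.
rewrite !bracketQE -scaleN1r -functions_on_piZr; apply/functions_onP => X OX.
by rewrite bracketC_antisym -[RHS]/(-1 * bracketC g f X) mulN1r.
Qed.

Lemma bracketQ_poisson : @poisson_algebra K Q *%R 1 bracketQ.
Proof.
split.
- exact: mulrA.
- exact: mulrC.
- exact: mul1r.
- move=> u k v w; rewrite mulrDr; congr (_ + _).
  elim/functions_on_ind: u => f; elim/functions_on_ind: v => g.
  rewrite -functions_on_piZr -!functions_on_piMr -functions_on_piZr.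
  apply/functions_onP => X OX.
  exact: (mulrCA (f X) k (g X)).
- move=> v k u w.
  by rewrite bracketQ_antisym bracketQ_linearr opprD -scalerN -!bracketQ_antisym.
- exact: bracketQ_linearr.
- elim/functions_on_ind => f; rewrite bracketQE -functions_on_pi0.
  (* Antisymmetry only gives that twice the value is 0; characteristic zero finishes. *)
  apply/functions_onP => X OX; apply/eqP; rewrite -[_ == _](mulrn_eq0 _ 2) mulr2n.
  by rewrite {1}bracketC_antisym addNr.
- elim/functions_on_ind => f; elim/functions_on_ind => g.
  elim/functions_on_ind => h; rewrite !bracketQE -!functions_on_piD.
  rewrite -functions_on_pi0; apply/functions_onP => X OX.
  exact: (mcp_bracket_jacobi KRC mcp (O_MC OX)).
- elim/functions_on_ind => f; elim/functions_on_ind => g.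
  elim/functions_on_ind => h.
  rewrite -functions_on_piMr !bracketQE -!functions_on_piMr -functions_on_piD.
  apply/functions_onP => X OX.
  rewrite -[RHS]/(bracketC f g X * h X + g X * bracketC f h X) !bracketCE.
  by rewrite dirD_CinftyM addrC [h X * _]mulrC.
Qed.

End PoissonQuotient.

Theorem theorem4p1 (K : numFieldType) (K_real_or_complex : real_or_complex K)
    (L : dgla K) (B : gcalg K) (pair : L -> B -> K) (mcp : is_MCP pair)
    (O : set (L1 L)) (O_MC : O `<=` @MC K L)
    (O_orbits : union_of_gauge_orbits O) :
  exists br : functions_on O -> functions_on O -> functions_on O,
    (forall f g : Cinfty (L1 L), exists h : Cinfty (L1 L),
       (forall X : L1 L, h X = mcp_bracket pair f g X) /\
       br (\pi_(functions_on O) f) (\pi_(functions_on O) g) =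
          \pi_(functions_on O) h) /\
    @poisson_algebra K (functions_on O) *%R 1 br.
Proof.
exists (@bracketQ K L B pair K_real_or_complex mcp O).
split=> [f g|]; last exact: bracketQ_poisson.
by exists (bracketC K_real_or_complex mcp f g); split=> //; exact: bracketQE.
Qed.
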